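(* Let $\Gamma$ be a Theta--network minimizing $F$ among all Theta--networks, i.e. $F(\Gamma)=\inf\{F(\Gamma')\mid\Gamma' \text{ is a Theta--network}\}$. Then $\Gamma$ is injective, i.e. each of the three curves of $\Gamma$ is injective (has no self-intersections).
   Context: A planar curve is given by a parametrization $\gamma:[0,1]\to\mathbb{R}^2$; it is regular if (it is at least $C^1$ and) $|\partial_x\gamma(x)|\neq 0$ for all $x\in[0,1]$. For a regular curve, $\partial_s=\frac{\partial_x}{|\partial_x\gamma|}$, $\mathrm{d}s=|\partial_x\gamma|\,\mathrm{d}x$, $\tau=\partial_s\gamma$ is the unit tangent, $\nu$ is the counterclockwise rotation of $\tau$ by $\pi/2$, and the scalar curvature $k$ is defined by $\partial_s^2\gamma=k\nu$ (a.e. for $H^2$ curves). A Theta--network $\Gamma=\{\gamma^1,\gamma^2,\gamma^3\}$ consists of three regular curves $\gamma^i:[0,1]\to\mathbb{R}^2$ of class $H^2$ that meet at two triple junctions $P^1=\gamma^1(0)=\gamma^2(0)=\gamma^3(0)$ and $P^2=\gamma^1(1)=\gamma^2(1)=\gamma^3(1)$, forming angles of $120$ degrees at both junctions: $\tau^1(0)+\tau^2(0)+\tau^3(0)=0$ and $\tau^1(1)+\tau^2(1)+\tau^3(1)=0$. The curves may intersect each other and may have self-intersections. The penalized elastic energy is $F(\Gamma)=\sum_{i=1}^3\int_{\gamma^i}\big((k^i)^2+1\big)\,\mathrm{d}s^i$. A network is called injective if each of its curves is injective. *)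

(* Defs.v *)
From mathcomp Require Import all_boot all_order all_algebra.
From mathcomp Require Import all_classical all_reals all_analysis.
From mathcomp Require Import ring lra.
Set Implicit Arguments.
Unset Strict Implicit.
Unset Printing Implicit Defensive.
Import Order.TTheory GRing.Theory Num.Theory.
Import numFieldNormedType.Exports.
Local Open Scope classical_set_scope.
Local Open Scope ring_scope.

(* A function on [0, 1] is represented by a total function R -> _ whose values
   outside [0, 1] are irrelevant: everything below, including the derivative at
   the endpoints (which is one-sided), depends only on the values on [0, 1]. *)

Section FunctionsOnUnitInterval.
Variable R : realType.
Implicit Types (f u phi : R -> R) (x : R).

Definition quotient01 f x : R -> R := fun y => (f y - f x) / (y - x).

Definition derivable01 f x : Prop :=
  cvg (quotient01 f x @ within `[0, 1] x^').

Definition deriv01 f x : R := lim (quotient01 f x @ within `[0, 1] x^').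

Definition C1_01 f : Prop :=
  (forall x, x \in `[0, 1] -> derivable01 f x) /\
  {within `[0, 1], continuous (deriv01 f)}.

(* Sobolev spaces on (0, 1), defined with weak derivatives; C^1 functions with
   compact support in (0, 1) are used as test functions. *)
Definition L2_01 u : Prop :=
  measurable_fun (`]0, 1[ : set R) u /\
  (\int[@lebesgue_measure R]_(x in `]0%R, 1%R[) ((u x) ^+ 2)%:E < +oo)%E.

Definition test_function phi : Prop :=
  [/\ forall x, derivable phi x 1,
      continuous (derive1 phi) &
      closure [set x | phi x != 0] `<=` `]0, 1[].

Definition H1_01 u : Prop :=
  L2_01 u /\
  exists2 g : R -> R, L2_01 g &
    forall phi, test_function phi ->
      \int[@lebesgue_measure R]_(x in `]0, 1[) (u x * derive1 phi x) =
      - \int[@lebesgue_measure R]_(x in `]0, 1[) (g x * phi x).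

(* H^2(0, 1) embeds in C^1([0, 1]), and functions of class H^2 are identified
   with their C^1 representative, whose weak derivative is the classical one. *)
Definition H2_01 f : Prop := C1_01 f /\ H1_01 (deriv01 f).

End FunctionsOnUnitInterval.

Section PlanarCurves.
Variable R : realType.
Implicit Types (gamma V : R -> R * R) (v w : R * R) (x : R).

(* The library norm on R * R is the sup norm, hence this definition. *)
Definition norm2 v : R := Num.sqrt (v.1 ^+ 2 + v.2 ^+ 2).

Definition dot2 v w : R := v.1 * w.1 + v.2 * w.2.

Definition partial_x V x : R * R :=
  (deriv01 (fun y => (V y).1) x, deriv01 (fun y => (V y).2) x).

Definition speed gamma x : R := norm2 (partial_x gamma x).

Definition partial_s gamma V x : R * R :=
  ((partial_x V x).1 / speed gamma x, (partial_x V x).2 / speed gamma x).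

Definition tangent gamma : R -> R * R := partial_s gamma gamma.

Definition normal gamma x : R * R :=
  (- (tangent gamma x).2, (tangent gamma x).1).

(* The k with partial_s^2 gamma = k nu; see [curvatureP]. *)
Definition curvature gamma x : R :=
  dot2 (partial_s gamma (tangent gamma) x) (normal gamma x).

Definition regular gamma : Prop :=
  [/\ C1_01 (fun x => (gamma x).1), C1_01 (fun x => (gamma x).2) &
      forall x, x \in `[0, 1] -> speed gamma x != 0].

Definition class_H2 gamma : Prop :=
  H2_01 (fun x => (gamma x).1) /\ H2_01 (fun x => (gamma x).2).

Definition curve_energy gamma : \bar R :=
  (\int[@lebesgue_measure R]_(x in `[0%R, 1%R])
     (((curvature gamma x) ^+ 2 + 1) * speed gamma x)%:E)%E.

Lemma within01_proper x : x \in `[0, 1] ->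
  ProperFilter (within `[0, 1] x^').
Proof.
move=> x01; apply: Build_ProperFilter_ex => A.
rewrite /within /= => /nbhs_ballP [e /= e0 eA].
have {}x01 : 0 <= x <= 1 by move: x01; rewrite in_itv.
pose d := Num.min (e / 2) (1 / 2).
have d0 : 0 < d by rewrite lt_min; apply/andP; split; lra.
have de : d < e by rewrite gt_min; apply/orP; left; lra.
have d2 : d <= 1 / 2 by rewrite ge_min lexx orbT.
case: (leP x (1 / 2)) => x2.
- exists (x + d); apply: eA => /=.
  + by rewrite /ball /= opprD addNKr normrN gtr0_norm.
  + by apply/eqP; lra.
  + by rewrite in_itv /=; lra.
- exists (x - d); apply: eA => /=.
  + by rewrite /ball /= opprB addrC subrK gtr0_norm.
  + by apply/eqP; lra.
  + by rewrite in_itv /=; lra.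
Qed.

Lemma tangent_unit gamma x : speed gamma x != 0 ->
  (tangent gamma x).1 ^+ 2 + (tangent gamma x).2 ^+ 2 = 1.
Proof.
move=> s0; rewrite /tangent /partial_s /= !expr_div_n -mulrDl.
have <- : speed gamma x ^+ 2 =
    (partial_x gamma x).1 ^+ 2 + (partial_x gamma x).2 ^+ 2.
  by rewrite sqr_sqrtr// addr_ge0// sqr_ge0.
by rewrite divff// expf_neq0.
Qed.

Lemma derivable01_cvg (f : R -> R) x : x \in `[0, 1] -> derivable01 f x ->
  f y @[y --> within `[0, 1] x^'] --> f x.
Proof.
move=> x01 df; have F := within01_proper x01.
have cx : (fun y : R => y - x) @ within `[0, 1] x^' --> (0 : R).
  rewrite -[X in _ --> X](subrr x); apply: cvgB; last exact: cvg_cst.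
  apply: cvg_trans; first exact: cvg_within.
  exact: nbhs_dnbhs.
have -> : f x = f x + lim (quotient01 f x @ within `[0, 1] x^') * 0.
  by rewrite mulr0 addr0.
have : (fun y => f x + quotient01 f x y * (y - x)) @ within `[0, 1] x^' -->
    f x + lim (quotient01 f x @ within `[0, 1] x^') * 0.
  by apply: cvgD; [exact: cvg_cst|exact: cvgM].
apply: cvg_trans; apply: near_eq_cvg.
rewrite near_withinE; near=> y => _; rewrite /quotient01 divfK ?subrKC//.
rewrite subr_eq0; near: y; exact: nbhs_dnbhs_neq.
Unshelve. all: by end_near. Qed.

Lemma curvatureP gamma x : regular gamma -> x \in `[0, 1] ->
  derivable01 (fun y => (tangent gamma y).1) x ->
  derivable01 (fun y => (tangent gamma y).2) x ->
  partial_s gamma (tangent gamma) x =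
    (curvature gamma x * (normal gamma x).1,
     curvature gamma x * (normal gamma x).2).
Proof.
move=> [_ _ s0] x01 d1 d2; have F := within01_proper x01.
set t := tangent gamma in d1 d2 *.
have tx : (t x).1 ^+ 2 + (t x).2 ^+ 2 = 1 by apply: tangent_unit; exact: s0.
set a := deriv01 (fun y => (t y).1) x.
set b := deriv01 (fun y => (t y).2) x.
have ab : a * ((t x).1 + (t x).1) + b * ((t x).2 + (t x).2) = 0.
  pose q y := quotient01 (fun y => (t y).1) x y * ((t y).1 + (t x).1) +
              quotient01 (fun y => (t y).2) x y * ((t y).2 + (t x).2).
  have q1 : q @ within `[0, 1] x^' -->
      a * ((t x).1 + (t x).1) + b * ((t x).2 + (t x).2).
    apply: cvgD; apply: cvgM => //; apply: cvgD; try exact: cvg_cst.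
    - exact: (derivable01_cvg x01 d1).
    - exact: (derivable01_cvg x01 d2).
  have q0 : q @ within `[0, 1] x^' --> (0 : R).
    have : (fun=> 0 : R) @ within `[0, 1] x^' --> (0 : R) by exact: cvg_cst.
    apply: cvg_trans; apply: near_eq_cvg.
    rewrite near_withinE; near=> y => y01.
    have ty : (t y).1 ^+ 2 + (t y).2 ^+ 2 = 1 by apply: tangent_unit; exact: s0.
    rewrite /q /quotient01 mulrAC [X in _ + X]mulrAC -mulrDl.
    rewrite (_ : _ + _ = 0) ?mul0r//.
    transitivity (((t y).1 ^+ 2 + (t y).2 ^+ 2) -
                  ((t x).1 ^+ 2 + (t x).2 ^+ 2)); first by ring.
    by rewrite ty tx subrr.
  exact: (cvg_unique _ q1 q0).
rewrite /curvature /normal -/t.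
have -> : partial_s gamma t x = (a / speed gamma x, b / speed gamma x) by [].
rewrite /dot2; set s := speed gamma x.
move: tx ab; case: (t x) => [p q] /= tx ab.
have ab0 : a * p + b * q = 0 by lra.
have -> : a / s * - q + b / s * p = s^-1 * (b * p - a * q) by ring.
congr pair.
- transitivity (s^-1 * (a * (p ^+ 2 + q ^+ 2) - p * (a * p + b * q))).
    by rewrite tx ab0; ring.
  by ring.
- transitivity (s^-1 * (b * (p ^+ 2 + q ^+ 2) - q * (a * p + b * q))).
    by rewrite tx ab0; ring.
  by ring.
Unshelve. all: by end_near. Qed.

End PlanarCurves.

Section ThetaNetworks.
Variable R : realType.
Implicit Types Gamma : 'I_3 -> R -> R * R.

Definition theta_network Gamma : Prop :=
  [/\ forall i, regular (Gamma i) /\ class_H2 (Gamma i),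
      forall i j, Gamma i 0 = Gamma j 0,
      forall i j, Gamma i 1 = Gamma j 1,
      \sum_(i < 3) tangent (Gamma i) 0 = 0 &
      \sum_(i < 3) tangent (Gamma i) 1 = 0].

Definition network_energy Gamma : \bar R :=
  (\sum_(i < 3) curve_energy (Gamma i))%E.

Definition network_injective Gamma : Prop :=
  forall i, {in `[0, 1] &, injective (Gamma i)}.

End ThetaNetworks.

(* Main.v *)
Require Import Defs.
From mathcomp Require Import all_boot all_order all_algebra.
From mathcomp Require Import all_classical all_reals all_analysis.
From mathcomp Require Import measurable_realfun ring lra.
Set Implicit Arguments.
Unset Strict Implicit.
Unset Printing Implicit Defensive.
Import Order.TTheory GRing.Theory Num.Theory.
Import numFieldNormedType.Exports.
Local Open Scope classical_set_scope.
Local Open Scope ring_scope.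

(* Let a curve of the network have a loop, with tails of total length [d]; write
   [L] for length and [W] for bending energy.

   The angle [th] between the tangent and its value at the midpoint (in
   arclength) of an arc satisfies [|th'| <= |k|], and
   [th ^ 2 >= pi ^ 2 / 4 - pi cos th]. As [cos th] integrates to at most the
   chord [X], Wirtinger's inequality, proved by calibration with a solution of
   a Riccati equation, gives [W >= w ^ 2 (pi ^ 2 / 4 L - pi X)] whenever
   [w L < pi]. With [w = 3.1 / L] and [X = 0], the loop has energy at least
   [3.1 pi].

   The other two curves form a closed curve with two interior angles of 120
   degrees, so Fenchel's theorem bounds their total curvature below by
   [4 pi / 3], hence their energy by [8 pi / 3]. If [d >= 1 / 3], the total of
   these bounds and of [d] exceeds the energy of the standard double bubble. If
   [d < 1 / 3], the two junctions are close: either the two curves are short,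
   and Fenchel's theorem gives more, or one of them is long, and is nearly a
   loop, so that the first bound applies.
*)

(** The fixed bounds [31 / 10 * pi] and [8 * pi / 3] add up to about 18.12, whereas the double
    bubble has energy about 18.41: this gap forces the discussion of the tails. The radius 9 / 10 is
    a rational value near the minimizer 0.91 of [8 * pi / 3 * (r + 1 / r) + sqrt 3 * r], and 3.1 a
    rational value below [pi], so that the Riccati solution has no pole.

    The analytic obstacle is that second derivatives are only square integrable, so the angle [th]
    is never differentiated. Inequalities are proved for small increments to the right of every
    point, with errors small against the integral of the second derivative, or against bending plus
    length, and are then added up. Nor is total curvature formed: Young's inequality
    [2 p |k| <= k ^ 2 + p ^ 2] replaces it by an additive combination of bending and length, with
    [p] free to be tuned. The lower bound for [th ^ 2] is linear in [cos th] because the chord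
    controls only the integral of [cos th]. *)

Section TrigonometricEstimates.
Variable R : realType.
Implicit Types x y : R.

(** Applied repeatedly, it integrates each Taylor bound for [sin] or [cos] into the next one. *)
Lemma ge0_of_derive_ge0 (f f' : R -> R) :
  (forall x, is_derive x 1 f (f' x)) -> (forall x, 0 <= x -> 0 <= f' x) ->
  f 0 = 0 -> forall x, 0 <= x -> 0 <= f x.
Proof.
move=> df f'0 f0 x x0.
have [|c cx] := @MVT_segment R f f' 0 x x0 (fun y _ => df y).
  apply: derivable_within_continuous => y _.
  exact: (@ex_derive _ _ _ _ _ _ _ (df y)).
rewrite f0 !subr0 => ->; apply: mulr_ge0 => //; apply: f'0.
by move: cx; rewrite in_itv /= => /andP[].
Qed.

Lemma sin_le_id x : 0 <= x -> sin x <= x.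
Proof.
move=> x0; rewrite -subr_ge0.
apply: (@ge0_of_derive_ge0 (fun y => y - sin y) (fun y => 1 - cos y)) => //.
by rewrite sin0 subrr.
Qed.

Lemma cos_ge2 x : 0 <= x -> 1 - x ^+ 2 / 2 <= cos x.
Proof.
move=> x0; rewrite -subr_ge0.
apply: (@ge0_of_derive_ge0 (fun y => cos y - (1 - y ^+ 2 / 2))
  (fun y => y - sin y)) _ _ _ _ x0.
- by move=> y; apply: is_derive_eq; rewrite /GRing.scale /=; field.
- by move=> y y0; rewrite subr_ge0 sin_le_id.
- by rewrite cos0; field.
Qed.

Lemma sin_ge3 x : 0 <= x -> x - x ^+ 3 / 6 <= sin x.
Proof.
move=> x0; rewrite -subr_ge0.
apply: (@ge0_of_derive_ge0 (fun y => sin y - (y - y ^+ 3 / 6))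
  (fun y => cos y - (1 - y ^+ 2 / 2))) _ _ _ _ x0.
- by move=> y; apply: is_derive_eq; rewrite /GRing.scale /=; field.
- by move=> y y0; rewrite subr_ge0 cos_ge2.
- by rewrite sin0; field.
Qed.

Lemma cos_le4 x : 0 <= x -> cos x <= 1 - x ^+ 2 / 2 + x ^+ 4 / 24.
Proof.
move=> x0; rewrite -subr_ge0.
apply: (@ge0_of_derive_ge0 (fun y => (1 - y ^+ 2 / 2 + y ^+ 4 / 24) - cos y)
  (fun y => sin y - (y - y ^+ 3 / 6))) _ _ _ _ x0.
- by move=> y; apply: is_derive_eq; rewrite /GRing.scale /=; field.
- by move=> y y0; rewrite subr_ge0 sin_ge3.
- by rewrite cos0; field.
Qed.

Lemma sin_le5 x : 0 <= x -> sin x <= x - x ^+ 3 / 6 + x ^+ 5 / 120.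
Proof.
move=> x0; rewrite -subr_ge0.
apply: (@ge0_of_derive_ge0 (fun y => (y - y ^+ 3 / 6 + y ^+ 5 / 120) - sin y)
  (fun y => (1 - y ^+ 2 / 2 + y ^+ 4 / 24) - cos y)) _ _ _ _ x0.
- by move=> y; apply: is_derive_eq; rewrite /GRing.scale /=; field.
- by move=> y y0; rewrite subr_ge0 cos_le4.
- by rewrite sin0; field.
Qed.

Lemma cos_pithird : cos (pi / 3) = 1 / 2 :> R.
Proof.
have c0 : 0 < cos (pi / 3 : R).
  by apply: cos_gt0_pihalf; have := pi_gt0 R => p0; apply/andP; split; lra.
have E : pi = pi / 3 + (pi / 3) *+ 2 :> R by rewrite mulr2n; lra.
have : cos (pi : R) = -1 by exact: cospi.
rewrite {1}E cosD cos_mulr2n sin_mulr2n.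
rewrite mulrnAr mulrCA -expr2 sin2cos2.
set c := cos (pi / 3) in c0 *; move=> H.
(* The triple-angle formula turns [cos pi = -1] into [4 c ^ 3 - 3 c + 1 = 0], which factors like
   this. *)
have : (c + 1) * (2 * c - 1) ^+ 2 = 0 by rewrite !mulr2n in H; lra.
move/eqP; rewrite mulf_eq0 expf_eq0 /= => /orP[/eqP|/eqP]; lra.
Qed.

Lemma sin_pithird : sin (pi / 3) = Num.sqrt 3 / 2 :> R.
Proof.
have s0 : 0 <= sin (pi / 3 : R).
  by apply: sin_ge0_pi; have := pi_gt0 R => p0; apply/andP; split; lra.
apply: (@pexpIrn _ 2) => //; rewrite ?nnegrE ?divr_ge0 ?sqrtr_ge0//.
by rewrite sin2cos2 cos_pithird [RHS]expr_div_n sqr_sqrtr//; field.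
Qed.

Lemma cos_2pithird : cos (2 * (pi / 3)) = - (1 / 2) :> R.
Proof. by rewrite mulr_natl cos_mulr2n cos_pithird mulr2n; field. Qed.

Lemma sin_2pithird : sin (2 * (pi / 3)) = Num.sqrt 3 / 2 :> R.
Proof.
by rewrite mulr_natl sin_mulr2n cos_pithird sin_pithird mulr2n; field.
Qed.

(** Otherwise [1 / 2 = sin (pi / 6)] would be at most [sin (31 / 60)], which the Taylor bound keeps
    below 0.495. *)
Lemma pi_gt31 : 31 / 10 < pi :> R.
Proof.
rewrite ltNge; apply/negP => p31.
have p2 := pi_ge2 R.
have := @sin_le5 (31 / 60) ltac:(lra).
suff : sin (pi / 6 : R) <= sin (31 / 60).
  have -> : pi / 6 = pi / 2 - pi / 3 :> R by field.
  by rewrite sinB sin_pihalf cos_pihalf cos_pithird; lra.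
have [->|ne] := eqVneq (pi / 6 : R) (31 / 60); first by [].
have lt6 : pi / 6 < 31 / 60 :> R by rewrite lt_neqAle ne; lra.
by apply/ltW; rewrite ltr_sin ?in_itv /=; lra.
Qed.

Lemma pi_lt33 : pi < 33 / 10 :> R.
Proof.
rewrite ltNge; apply/negP => p33.
have p2 := pi_ge2 R.
have := @cos_le4 (33 / 30) ltac:(lra).
suff : cos (pi / 3) <= cos (33 / 30 : R) by rewrite cos_pithird; lra.
have [->|ne] := eqVneq (pi / 3) (33 / 30 : R); first by [].
have lt3 : 33 / 30 < pi / 3 :> R by rewrite lt_neqAle eq_sym ne; lra.
by apply/ltW; rewrite ltr_cos ?in_itv /=; lra.
Qed.

(* [arccos ^ 2] is convex: this is its tangent line at [0]. *)
Lemma sqr_ge_cos x : 0 <= x <= pi -> pi ^+ 2 / 4 - pi * cos x <= x ^+ 2.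
Proof.
move=> /andP[x0 xpi]; have p0 := pi_gt0 R; have p3 := pi_lt33.
rewrite (_ : cos x = sin (pi / 2 - x)); last first.
  by rewrite sinB sin_pihalf cos_pihalf; ring.
have [xl|xg] := leP x (pi / 2).
(* In terms of [u] the claim reads [pi u - u ^ 2 <= pi sin u]; the cubic bound for [sin] suffices
   because [pi u <= 6]. *)
- set u := pi / 2 - x; have u0 : 0 <= u by rewrite /u; lra.
  have up : u <= pi / 2 by rewrite /u; lra.
  have -> : x = pi / 2 - u by rewrite /u; ring.
  have := ler_wpM2l (ltW p0) (sin_ge3 u0).
  have : 0 <= u ^+ 2 * (6 - pi * u).
    apply: mulr_ge0; first exact: sqr_ge0.
    rewrite subr_ge0 (@le_trans _ _ (33 / 10 * (33 / 20)))//; last lra.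
    by apply: ler_pM; lra.
  lra.
- rewrite -(opprB x) sinN; set u := x - pi / 2.
  have -> : x = pi / 2 + u by rewrite /u; ring.
  have u0 : 0 <= u by rewrite /u; lra.
  have := ler_wpM2l (ltW p0) (sin_le_id u0); have := sqr_ge0 u; lra.
Qed.

(** This is [x <= tan x] without the division, hence valid for obtuse angles too; the difference has
    derivative [y * sin y]. *)
Lemma sin_ge_mul_cos x : 0 <= x <= pi -> x * cos x <= sin x.
Proof.
move=> /andP[x0 xp]; rewrite -subr_ge0.
have df y : is_derive y 1 (fun z => sin z - z * cos z) (y * sin y).
  by apply: is_derive_eq; rewrite /GRing.scale /=; ring.
have [|c cx] := @MVT_segment R _ _ 0 x x0 (fun y _ => df y).
  apply: derivable_within_continuous => y _.
  exact: (@ex_derive _ _ _ _ _ _ _ (df y)).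
rewrite sin0 mul0r subr0 !subr0 => ->; apply: mulr_ge0 => //.
move: cx; rewrite in_itv /= => /andP[c0 cx]; apply: mulr_ge0 => //.
by apply: sin_ge0_pi; rewrite c0 (le_trans cx).
Qed.

End TrigonometricEstimates.

(** * Monotonicity deduced from local estimates on one side, without derivatives *)

Section MonotonicityFromRightIncrements.
Variable R : realType.
Implicit Types (G M : R -> R) (a b x y e : R).

(** Continuity puts the supremum of the points where [G] is at least [G a] into that set, and the
    local hypothesis moves past it unless it is [b]. *)
Lemma le_of_near_right G a b : a <= b -> {within `[a, b], continuous G} ->
  (forall x, a <= x < b -> \forall y \near x^'+, G x <= G y) -> G a <= G b.
Proof.
move=> ab cG nG; rewrite leNgt; apply/negP => Gba.
pose S := [set x | a <= x <= b /\ G a <= G x].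
have aS : S a by split; [rewrite lexx|].
have ubS : ubound S b by move=> x [/andP[]].
have supS : has_sup S by split; [exists a|exists b].
set c := sup S.
have ac : a <= c by apply: (ub_le_sup _ aS); exists b.
have cb : c <= b by apply: ge_sup => //; exists a.
have Gc : G a <= G c.
  rewrite leNgt; apply/negP => Gca.
  have /subspace_continuousP/(_ c) := cG.
  rewrite /= in_itv /= ac cb => /(_ isT) /cvgr_lt /(_ _ Gca).
  rewrite near_withinE => /nbhs_ballP[e /= e0 He].
  have [y Sy] := sup_adherent e0 supS; rewrite -/c => cey.
  have yc : y <= c by apply: ub_le_sup => //; exists b.
  case: Sy => /andP[ay yb]; apply/negP; rewrite -ltNge; apply: He.
    by rewrite /ball /= ger0_norm ?subr_ge0//; lra.
  by rewrite /= in_itv /= ay.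
have {}cb : c < b.
  by rewrite lt_neqAle cb andbT; apply: contraTneq Gba => <-; rewrite -leNgt.
have [y /and3P[cy yb Gy]] : exists y, [&& c < y, y < b & G c <= G y].
  near c^'+ => y; exists y; apply/and3P; split.
  - by near: y; exact: nbhs_right_gt.
  - by near: y; exact: nbhs_right_lt.
  - by near: y; apply: nG; rewrite ac.
have : y <= c.
  apply: ub_le_sup; first by exists b.
  by split; [rewrite (le_trans ac (ltW cy)) ltW|exact: le_trans Gy].
by rewrite leNgt cy.
Unshelve. all: by end_near. Qed.

(** Losses are measured against a function [M] rather than against [y - x]: for an unbounded second
    derivative the errors are only small relative to an integral of its modulus. *)
Lemma le_of_near_right_increments G M a b : a <= b ->
  {within `[a, b], continuous G} -> {within `[a, b], continuous M} ->
  (forall x e, a <= x < b -> 0 < e ->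
     \forall y \near x^'+, G x - G y <= e * (M y - M x)) ->
  G a <= G b.
Proof.
move=> ab cG cM nG; rewrite leNgt; apply/negP => Gba.
(* With this [e] the accumulated loss is at most half of the supposed drop of [G]. *)
pose e := (G a - G b) / (2 * (`|M b - M a| + 1)).
have e0 : 0 < e by rewrite divr_gt0 ?subr_gt0 ?mulr_gt0 ?ltr_wpDl.
have : G a + e * M a <= G b + e * M b.
  apply: (@le_of_near_right (fun x => G x + e * M x)) => //.
    move=> /= x; apply: cvgD; first exact: cG.
    by apply: cvgM; [exact: cvg_cst|exact: cM].
  move=> x xab; near=> y.
  have : G x - G y <= e * (M y - M x) by near: y; exact: nG.
  lra.
have : e * (M b - M a) <= (G a - G b) / 2.
  rewrite /e mulrAC ler_pdivrMr ?mulr_gt0 ?ltr_wpDl//.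
  rewrite (_ : _ / 2 * _ = (G a - G b) * (`|M b - M a| + 1)); last by field.
  rewrite ler_pM2l ?subr_gt0//; have := ler_norm (M b - M a); lra.
lra.
Unshelve. all: by end_near. Qed.

End MonotonicityFromRightIncrements.

(** * Integrals over segments of locally integrable functions *)

Section IntervalIntegrals.
Variable R : realType.
Implicit Types (f g h : R -> R) (a b x y z e : R).
Local Notation mu := (@lebesgue_measure R).

Definition itv_integrable f := forall x y, mu.-integrable `[x, y] (EFin \o f).
(** Unoriented: for [y < x] the segment is empty and the value is [0], whence the hypotheses
    [x <= y] wherever integrals are added. *)
Definition itv_integral f x y := \int[mu]_(t in `[x, y]) f t.

Local Notation I := itv_integral.

Lemma itv_integrable_measurable f x y :
  itv_integrable f -> measurable_fun `[x, y] f.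
Proof. by move=> /(_ x y) /(measurable_int mu) /measurable_EFinP. Qed.

Lemma continuous_itv_integrable f : continuous f -> itv_integrable f.
Proof.
move=> cf x y; apply: continuous_compact_integrable.
  exact: segment_compact.
exact: continuous_subspaceT.
Qed.

Lemma itv_integrableD f g : itv_integrable f -> itv_integrable g ->
  itv_integrable (fun x => f x + g x).
Proof. by move=> If Ig x y; apply: (integrableD _ (If x y) (Ig x y)). Qed.

Lemma itv_integrableM f h : itv_integrable f -> continuous h ->
  itv_integrable (fun x => f x * h x).
Proof.
move=> If ch x y.
have mh := itv_integrable_measurable (x := x) (y := y)
  (continuous_itv_integrable ch).
suff bh : [bounded h t | t in `[x, y]].
  exact: (integrableMl _ (If x y) mh bh).
have /compact_bounded : compact (h @` `[x, y]).
  apply: continuous_compact (@segment_compact _ x y).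
  exact: continuous_subspaceT.
move=> [M [Mr MB]]; exists M; split=> // N MN t txy; exact: MB.
Qed.

Lemma itv_integrableZ c f : itv_integrable f ->
  itv_integrable (fun x => c * f x).
Proof.
move=> If; under eq_fun do rewrite mulrC.
by apply: itv_integrableM => //; exact: cst_continuous.
Qed.

Lemma itv_integrable_norm f : itv_integrable f ->
  itv_integrable (fun x => `|f x|).
Proof. by move=> If x y; exact: integrable_norm (If x y). Qed.

Lemma itv_integrable_le f g : measurable_fun setT f -> itv_integrable g ->
  (forall x, `|f x| <= g x) -> itv_integrable f.
Proof.
move=> mf Ig fg x y; apply: le_integrable (Ig x y) => //.
  by apply/measurable_EFinP; exact: measurable_funTS.
by move=> t _ /=; rewrite lee_fin (le_trans (fg t))// ler_norm.
Qed.

Lemma itv_integral_split f x y z : itv_integrable f -> x <= y -> y <= z ->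
  I f x z = I f x y + I f y z.
Proof.
move=> If xy yz; rewrite [I f y z](_ : _ = I f x z - I f x y); first by ring.
have := @Rintegral_itvB _ f (BLeft x) (BRight z) y (If x z).
rewrite !bnd_simp => /(_ xy yz) ->; rewrite Rintegral_itv_obnd_cbnd//.
by apply: integrableS (If y z) => //; apply: subset_itvr; rewrite bnd_simp.
Qed.

Lemma itv_integral1 f x : I f x x = 0.
Proof. by rewrite /I set_itv1 Rintegral_set1. Qed.

Lemma itv_integralD f g x y : itv_integrable f -> itv_integrable g ->
  I (fun t => f t + g t) x y = I f x y + I g x y.
Proof. by move=> If Ig; apply: RintegralD. Qed.

Lemma itv_integralZ c f x y : itv_integrable f ->
  I (fun t => c * f t) x y = c * I f x y.
Proof. by move=> If; apply: RintegralZl. Qed.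

Lemma itv_integral_cst c x y : x <= y -> I (fun=> c) x y = c * (y - x).
Proof.
move=> xy; rewrite /I Rintegral_cst//.
congr (_ * _); apply: (etrans (congr1 fine (@lebesgue_measure_itv R `[x, y]))).
rewrite /= lte_fin.
by case: ltgtP xy => // -> _; rewrite subrr.
Qed.

Lemma le_itv_integral f g x y : itv_integrable f -> itv_integrable g ->
  (forall t, x <= t <= y -> f t <= g t) -> I f x y <= I g x y.
Proof.
move=> If Ig fg; apply: le_Rintegral => // t /=; rewrite in_itv /=; exact: fg.
Qed.

Lemma itv_integral_ge0 f x y : (forall t, x <= t <= y -> 0 <= f t) ->
  0 <= I f x y.
Proof.
move=> f0; apply: Rintegral_ge0 => t /=; rewrite in_itv /=; exact: f0.
Qed.

Lemma norm_itv_integral f x y : itv_integrable f ->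
  `|I f x y| <= I (fun t => `|f t|) x y.
Proof. by move=> If; apply: le_normr_Rintegral. Qed.

Lemma eq_itv_integral f g x y : (forall t, x <= t <= y -> f t = g t) ->
  I f x y = I g x y.
Proof.
move=> fg; apply: eq_Rintegral => t; rewrite inE /= in_itv /=; exact: fg.
Qed.

Lemma itv_integral_continuous f a b : itv_integrable f -> a <= b ->
  {within `[a, b], continuous (I f a)}.
Proof.
by move=> If ab; apply: (parameterized_integral_continuous ab (If a b)).
Qed.

Lemma itv_integral_gt0 f a b : continuous f -> a < b ->
  (forall t, a <= t <= b -> 0 < f t) -> 0 < I f a b.
Proof.
move=> cf ab f0.
have [c cab fc] := EVT_min (ltW ab) (continuous_subspaceT cf).
have {}cab : a <= c <= b by rewrite in_itv in cab.
apply: (@lt_le_trans _ _ (I (fun=> f c) a b)).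
  by rewrite itv_integral_cst ?ltW// mulr_gt0 ?subr_gt0 ?f0.
apply: le_itv_integral; try exact: continuous_itv_integrable.
  by apply: continuous_itv_integrable; exact: cst_continuous.
by move=> t tab; apply: fc; rewrite in_itv.
Qed.

Lemma itv_integral_near f x e : continuous f -> 0 < e ->
  \forall y \near x^'+, `|I f x y - f x * (y - x)| <= e * (y - x).
Proof.
move=> cf e0; have /cvgr_dist_le /(_ _ e0) := cf x.
move=> /nbhs_ballP[d /= d0 fd]; near=> y.
have xy : x < y by near: y; exact: nbhs_right_gt.
have yd : y < x + d by near: y; apply: nbhs_right_lt; rewrite ltrDl.
have If := continuous_itv_integrable cf.
have Ic c : itv_integrable (fun=> c : R).
  by apply: continuous_itv_integrable; exact: cst_continuous.
have B t : x <= t <= y -> `|f x - f t| <= e.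
  move=> /andP[xt ty]; apply: fd; rewrite /ball /= distrC ger0_norm ?subr_ge0//.
  lra.
have lo t : x <= t <= y -> f x - e <= f t by move=> /B; rewrite ler_distl; lra.
have hi t : x <= t <= y -> f t <= f x + e by move=> /B; rewrite ler_distl; lra.
have := le_itv_integral (Ic (f x - e)) If lo.
have := le_itv_integral If (Ic (f x + e)) hi.
have xy' := ltW xy; by rewrite !itv_integral_cst// ler_distl; lra.
Unshelve. all: by end_near. Qed.

End IntervalIntegrals.

(** * Unoriented angles between unit vectors of the plane *)

Section PlaneAngles.
Variable R : realType.
Implicit Types p q r : R * R.

Definition unit2 p := p.1 ^+ 2 + p.2 ^+ 2 = 1.
Definition cross2 p q : R := p.1 * q.2 - p.2 * q.1.
Definition angle p q : R := acos (dot2 p q).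

Lemma dot2C p q : dot2 p q = dot2 q p.
Proof. by rewrite /dot2; ring. Qed.

Lemma dot2_cross2 p q : unit2 p -> unit2 q ->
  dot2 p q ^+ 2 + cross2 p q ^+ 2 = 1.
Proof.
move=> up uq; rewrite /dot2 /cross2 -[RHS]mulr1 -{1}up -uq; ring.
Qed.

Lemma dot2_bound p q : unit2 p -> unit2 q -> -1 <= dot2 p q <= 1.
Proof.
move=> up uq; have := dot2_cross2 up uq; have := sqr_ge0 (cross2 p q).
by move=> c0 dc; apply/andP; split; nra.
Qed.

Lemma cos_angle p q : unit2 p -> unit2 q -> cos (angle p q) = dot2 p q.
Proof. by move=> up uq; rewrite acosK// in_itv /= dot2_bound. Qed.

Lemma sin_angle p q : unit2 p -> unit2 q -> sin (angle p q) = `|cross2 p q|.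
Proof.
move=> up uq; rewrite sin_acos ?dot2_bound//.
by rewrite -(dot2_cross2 up uq) addrC addKr sqrtr_sqr.
Qed.

Lemma angle_ge0 p q : unit2 p -> unit2 q -> 0 <= angle p q.
Proof. by move=> up uq; rewrite acos_ge0// dot2_bound. Qed.

Lemma angle_le_pi p q : unit2 p -> unit2 q -> angle p q <= pi.
Proof. by move=> up uq; rewrite acos_lepi// dot2_bound. Qed.

Lemma angleC p q : angle p q = angle q p.
Proof. by rewrite /angle dot2C. Qed.

Lemma anglexx p : unit2 p -> angle p p = 0.
Proof.
move=> up; rewrite /angle (_ : dot2 p p = 1) ?acos1//.
Qed.

(** [dot2 p r] equals [dot2 p q * dot2 q r - cross2 p q * cross2 q r], which is at least the cosine
    of the sum of the two unoriented angles. *)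
Lemma angle_triangle p q r : unit2 p -> unit2 q -> unit2 r ->
  angle p r <= angle p q + angle q r.
Proof.
move=> up uq ur; rewrite leNgt; apply/negP => lt_pqr.
have apr := angle_le_pi up ur.
have apq := angle_ge0 up uq; have aqr := angle_ge0 uq ur.
have : cos (angle p r) < cos (angle p q + angle q r).
  rewrite ltr_cos// in_itv /=; apply/andP; split => //; lra.
rewrite cosD !cos_angle// !sin_angle// -normrM; apply/negP; rewrite -leNgt.
rewrite lerBlDr (le_trans _ (lerD (lexx _) (ler_norm _)))//.
(* The factor [|q| ^ 2 = 1] makes the two sides homogeneous, so that they agree as polynomials. *)
rewrite -[dot2 p r]mulr1 -uq.
by rewrite le_eqVlt; apply/orP; left; apply/eqP; rewrite /dot2 /cross2; ring.
Qed.

Lemma angle_mul_dot2_le p q : unit2 p -> unit2 q ->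
  angle p q * dot2 p q <= `|cross2 p q|.
Proof.
move=> up uq; rewrite -sin_angle// -cos_angle//; apply: sin_ge_mul_cos.
by rewrite angle_ge0// angle_le_pi.
Qed.

End PlaneAngles.

Section AngleContinuity.
Variable R : realType.
Variable T : R -> R * R.
Hypothesis T1c : continuous (fun x => (T x).1).
Hypothesis T2c : continuous (fun x => (T x).2).
Hypothesis unitT : forall x, unit2 (T x).

Lemma dot2_continuous p : continuous (fun y => dot2 p (T y)).
Proof.
by move=> x; apply: cvgD; apply: cvgM; [exact: cvg_cst|exact: T1c|
  exact: cvg_cst|exact: T2c].
Qed.

Lemma near_angle_lt x e : 0 < e -> \forall y \near x, angle (T x) (T y) < e.
Proof.
move=> e0.
have Txx : dot2 (T x) (T x) = 1.
  by have := unitT x; rewrite /unit2 /dot2 -!expr2.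
have /cvgr_gt/(_ (1 / 2)) dotc := @dot2_continuous (T x) x.
have crossc : (fun y => cross2 (T x) (T y)) @ x --> (0 : R).
  rewrite (_ : 0 = cross2 (T x) (T x)); last by rewrite /cross2; ring.
  by apply: cvgB; apply: cvgM; [exact: cvg_cst|exact: T2c|
    exact: cvg_cst|exact: T1c].
have e2 : 0 < e / 2 by lra.
have /cvgr0_norm_lt/(_ _ e2) cross0 := crossc.
near=> y.
have d2 : 1 / 2 < dot2 (T x) (T y) by near: y; apply: dotc; rewrite Txx; lra.
have c2 : `|cross2 (T x) (T y)| < e / 2 by near: y.
have := angle_mul_dot2_le (unitT x) (unitT y).
by have := angle_ge0 (unitT x) (unitT y); nra.
Unshelve. all: by end_near. Qed.

Lemma angle_continuous p : unit2 p -> continuous (fun y => angle p (T y)).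
Proof.
move=> up x; apply/cvgrPdist_lt => e e0; near=> y.
have Txy : angle (T x) (T y) < e by near: y; exact: near_angle_lt.
have := angle_triangle up (unitT x) (unitT y).
have := angle_triangle up (unitT y) (unitT x); rewrite (angleC (T y)).
by rewrite ltr_norml; lra.
Unshelve. all: by end_near. Qed.

End AngleContinuity.

(* Velocity of a regular [H^2] curve, extended to the whole line so that no
   one-sided derivative is needed; [acc] is its weak derivative. *)
Record velocity (R : realType) := Velocity {
  vel : R -> R * R;
  acc : R -> R * R;
  vel1_continuous : continuous (fun x => (vel x).1);
  vel2_continuous : continuous (fun x => (vel x).2);
  vel_neq0 : forall x, norm2 (vel x) != 0;
  acc1_measurable : measurable_fun setT (fun x => (acc x).1);
  acc2_measurable : measurable_fun setT (fun x => (acc x).2);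
  acc1_sqr_integrable : itv_integrable (fun x => (acc x).1 ^+ 2);
  acc2_sqr_integrable : itv_integrable (fun x => (acc x).2 ^+ 2);
  vel1_increment : forall x y, x <= y ->
    (vel y).1 - (vel x).1 = itv_integral (fun t => (acc t).1) x y;
  vel2_increment : forall x y, x <= y ->
    (vel y).2 - (vel x).2 = itv_integral (fun t => (acc t).2) x y }.

(** * Arclength, curvature and bending energy of a velocity field *)

Section VelocityFields.
Variable R : realType.
Implicit Types (c : velocity R) (x y p : R).

Definition vspeed c x := norm2 (vel c x).
Definition vtan c x : R * R :=
  ((vel c x).1 / vspeed c x, (vel c x).2 / vspeed c x).
(** The determinant formula for signed curvature. Written with [acc], it is measurable and involves
    no derivative of the tangent; [curvature_vcurv] relates it to [curvature]. *)
Definition vcurv c x : R :=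
  ((acc c x).2 * (vel c x).1 - (acc c x).1 * (vel c x).2) / vspeed c x ^+ 3.
Definition vlen c x y := itv_integral (vspeed c) x y.
Definition vbend c x y :=
  itv_integral (fun t => vcurv c t ^+ 2 * vspeed c t) x y.

Lemma vspeed_gt0 c x : 0 < vspeed c x.
Proof. by rewrite lt_neqAle eq_sym vel_neq0 sqrtr_ge0. Qed.

Lemma vspeed_sqr c x : vspeed c x ^+ 2 = (vel c x).1 ^+ 2 + (vel c x).2 ^+ 2.
Proof. by rewrite sqr_sqrtr// addr_ge0// sqr_ge0. Qed.

Lemma vspeed_continuous c : continuous (vspeed c).
Proof.
move=> x; apply: (@continuous_comp _ _ _
  (fun y => (vel c y).1 ^+ 2 + (vel c y).2 ^+ 2) Num.sqrt);
  last exact: sqrt_continuous.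
by apply: cvgD; rewrite /GRing.exp /=; apply: cvgM;
  solve [exact: vel1_continuous|exact: vel2_continuous].
Qed.

Lemma vspeedV_continuous c : continuous (fun x => (vspeed c x)^-1).
Proof.
by move=> x; apply: cvgV; [exact: vel_neq0|exact: vspeed_continuous].
Qed.

Lemma vtan_unit c x : unit2 (vtan c x).
Proof.
rewrite /unit2 /vtan /= !expr_div_n -mulrDl -vspeed_sqr divff//.
by rewrite expf_neq0// vel_neq0.
Qed.

Lemma vtan1_continuous c : continuous (fun x => (vtan c x).1).
Proof.
by move=> x; apply: cvgM; [exact: vel1_continuous|exact: vspeedV_continuous].
Qed.

Lemma vtan2_continuous c : continuous (fun x => (vtan c x).2).
Proof.
by move=> x; apply: cvgM; [exact: vel2_continuous|exact: vspeedV_continuous].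
Qed.

Lemma le_sqrD1 x : `|x| <= x ^+ 2 + 1.
Proof.
have := sqr_ge0 (`|x| - 1 / 2); rewrite -(real_normK (num_real x)); nra.
Qed.

Lemma itv_integrable_cst (k : R) : itv_integrable (fun=> k).
Proof. by apply: continuous_itv_integrable; exact: cst_continuous. Qed.

Lemma acc1_integrable c : itv_integrable (fun x => (acc c x).1).
Proof.
apply: (itv_integrable_le (acc1_measurable c)
  (itv_integrableD (acc1_sqr_integrable c) (itv_integrable_cst 1))).
by move=> x; exact: le_sqrD1.
Qed.

Lemma acc2_integrable c : itv_integrable (fun x => (acc c x).2).
Proof.
apply: (itv_integrable_le (acc2_measurable c)
  (itv_integrableD (acc2_sqr_integrable c) (itv_integrable_cst 1))).
by move=> x; exact: le_sqrD1.
Qed.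

(** The density is the squared determinant of [vel] and [acc], dominated by the squares of [acc],
    times the continuous factor [vspeed ^ -5]. *)
Lemma vcurv_sqr_integrable c :
  itv_integrable (fun t => vcurv c t ^+ 2 * vspeed c t).
Proof.
pose n t := (acc c t).2 * (vel c t).1 - (acc c t).1 * (vel c t).2.
have -> : (fun t => vcurv c t ^+ 2 * vspeed c t) =
    (fun t => n t ^+ 2 * ((vspeed c t)^-1 ^+ 5)).
  apply/funext => t; rewrite /vcurv -/(n t).
  have := vel_neq0 c t; rewrite -/(vspeed c t) => v0; field.
  by rewrite v0.
apply: itv_integrableM; last first.
  move=> x; have vx := @vspeedV_continuous c x.
  by rewrite /GRing.exp /=; do 4 (apply: cvgM; first exact: vx).
apply: (@itv_integrable_le _ _ (fun t => 2 *
  ((acc c t).2 ^+ 2 * (vel c t).1 ^+ 2 + (acc c t).1 ^+ 2 * (vel c t).2 ^+ 2))).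
- apply: measurable_funX; apply: measurable_funB; apply: measurable_funM.
  + exact: acc2_measurable.
  + exact: continuous_measurable_fun (@vel1_continuous _ c).
  + exact: acc1_measurable.
  + exact: continuous_measurable_fun (@vel2_continuous _ c).
- apply: itv_integrableZ; apply: itv_integrableD; apply: itv_integrableM.
  + exact: acc2_sqr_integrable.
  + by move=> x; rewrite /GRing.exp /=; apply: cvgM; exact: vel1_continuous.
  + exact: acc1_sqr_integrable.
  + by move=> x; rewrite /GRing.exp /=; apply: cvgM; exact: vel2_continuous.
- move=> t; rewrite ger0_norm ?sqr_ge0// /n.
  have := sqr_ge0 ((acc c t).2 * (vel c t).1 + (acc c t).1 * (vel c t).2); lra.
Qed.

End VelocityFields.

(** * The turning of the tangent is controlled by bending and length *)

Section TangentVariation.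
Variable R : realType.
Implicit Types (c : velocity R) (x y p e : R).

Lemma near_right_itv (P : R -> Prop) x :
  (\forall y \near x, P y) ->
  \forall y \near x^'+, forall t, x <= t <= y -> P t.
Proof.
move=> /nbhs_ballP[d /= d0 dP]; near=> y => t /andP[xt ty]; apply: dP.
have yd : y < x + d by near: y; apply: nbhs_right_lt; rewrite ltrDl.
by rewrite /ball /= distrC ger0_norm ?subr_ge0//; lra.
Unshelve. all: by end_near. Qed.

Lemma energy_density_integrable c p :
  itv_integrable (fun t => (vcurv c t ^+ 2 + p ^+ 2) * vspeed c t).
Proof.
have -> : (fun t => (vcurv c t ^+ 2 + p ^+ 2) * vspeed c t) =
    (fun t => vcurv c t ^+ 2 * vspeed c t + p ^+ 2 * vspeed c t).
  by apply/funext => t; rewrite mulrDl.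
apply: itv_integrableD; first exact: vcurv_sqr_integrable.
apply: itv_integrableZ.
exact: continuous_itv_integrable (@vspeed_continuous _ c).
Qed.

Lemma energy_densityE c p x y :
  itv_integral (fun t => (vcurv c t ^+ 2 + p ^+ 2) * vspeed c t) x y =
  vbend c x y + p ^+ 2 * vlen c x y.
Proof.
rewrite /vbend /vlen -itv_integralZ; last first.
  exact: continuous_itv_integrable (@vspeed_continuous _ c).
rewrite -itv_integralD; first by apply: eq_itv_integral => t _; rewrite mulrDl.
  exact: vcurv_sqr_integrable.
apply: itv_integrableZ.
exact: continuous_itv_integrable (@vspeed_continuous _ c).
Qed.

(** The tangent at [x] is parallel to [vel c x], so its cross product with [vel c y] sees only the
    increment of the velocity, an integral of [acc]. *)
Lemma cross2_vtan_increment c x y : x <= y ->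
  cross2 (vtan c x) (vtan c y) = itv_integral
    (fun t => (vtan c x).1 * (acc c t).2 + - (vtan c x).2 * (acc c t).1) x y
    / vspeed c y.
Proof.
move=> xy; rewrite itv_integralD.
- rewrite !itv_integralZ ?acc1_integrable ?acc2_integrable//;
    try (exact: acc1_integrable || exact: acc2_integrable).
  rewrite -vel1_increment// -vel2_increment// /cross2 /vtan /=.
  have := vel_neq0 c x; rewrite -/(vspeed c x) => v0.
  have := vel_neq0 c y; rewrite -/(vspeed c y) => v1.
  by field; rewrite v0 v1.
- by apply: itv_integrableZ; exact: acc2_integrable.
- by apply: itv_integrableZ; exact: acc1_integrable.
Qed.

(** For nearby points the angle is at most the cross product over the scalar product, hence at most
    the integral of [|vcurv| * vspeed] up to coefficients that are uniformly close; Young's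
    inequality then trades curvature for bending and length. *)
Lemma near_angle_vtan_le c p x e : 0 <= p -> 0 < e ->
  \forall y \near x^'+, 2 * p * angle (vtan c x) (vtan c y) <=
    vbend c x y + p ^+ 2 * vlen c x y +
    e * itv_integral (fun t => `|(acc c t).1| + `|(acc c t).2|) x y.
Proof.
move=> p0 e0; pose T := vtan c; pose v := vspeed c.
pose d := e / (2 * p + 1).
have d0 : 0 < d by rewrite divr_gt0//; lra.
have pd : 2 * p * d <= e.
  have : d * (2 * p + 1) = e by rewrite divfK// lt0r_neq0//; lra.
  by lra.
have Tv1 : (fun y => (T y).1 / v y) y @[y --> x] --> (T x).1 / v x.
  by apply: cvgM; [exact: vtan1_continuous|exact: vspeedV_continuous].
have Tv2 : (fun y => (T y).2 / v y) y @[y --> x] --> (T x).2 / v x.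
  by apply: cvgM; [exact: vtan2_continuous|exact: vspeedV_continuous].
have dotc := @dot2_continuous _ T (@vtan1_continuous _ c)
  (@vtan2_continuous _ c) (T x) x.
have Txx : dot2 (T x) (T x) = 1.
  by have := vtan_unit c x; rewrite /unit2 /dot2 -!expr2.
(* The factor relating the integral in [cross2_vtan_increment] to the tangent of the angle. *)
pose k y := (dot2 (T x) (T y))^-1 / v y.
have kc : k y @[y --> x] --> (v x)^-1.
  have -> : (v x)^-1 = (dot2 (T x) (T x))^-1 / v x by rewrite Txx invr1 mul1r.
  apply: cvgM; last exact: vspeedV_continuous.
  by apply: cvgV; [rewrite Txx oner_neq0|exact: dotc].
have k1 : (k y * (T x).1) @[y --> x] --> (T x).1 / v x.
  by rewrite [X in _ --> X]mulrC; apply: cvgM; [exact: kc|exact: cvg_cst].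
have k2 : (k y * (T x).2) @[y --> x] --> (T x).2 / v x.
  by rewrite [X in _ --> X]mulrC; apply: cvgM; [exact: kc|exact: cvg_cst].
have d2 : 0 < d / 2 by lra.
have /cvgr_dist_lt /(_ _ d2) nTv1 := Tv1.
have /cvgr_dist_lt /(_ _ d2) nTv2 := Tv2.
have /cvgr_dist_lt /(_ _ d2) nk1 := k1.
have /cvgr_dist_lt /(_ _ d2) nk2 := k2.
have ndot : \forall y \near x, 0 < dot2 (T x) (T y).
  by move/cvgr_gt : dotc; apply; rewrite Txx ltr01.
near=> y.
have xy : x <= y by near: y; exact: nbhs_right_ge.
have dot_gt0 : 0 < dot2 (T x) (T y) by near: y; exact: cvg_within.
have v0 z : v z != 0 := vel_neq0 c z.
have k1y : `|(T x).1 / v x - k y * (T x).1| < d / 2.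
  by near: y; exact: cvg_within.
have k2y : `|(T x).2 / v x - k y * (T x).2| < d / 2.
  by near: y; exact: cvg_within.
have T1y : forall t, x <= t <= y -> `|(T x).1 / v x - (T t).1 / v t| < d / 2.
  by near: y; exact: near_right_itv.
have T2y : forall t, x <= t <= y -> `|(T x).2 / v x - (T t).2 / v t| < d / 2.
  by near: y; exact: near_right_itv.
have n12 : itv_integrable (fun t => `|(acc c t).1| + `|(acc c t).2|).
  by apply: itv_integrableD; apply: itv_integrable_norm;
    [exact: acc1_integrable|exact: acc2_integrable].
pose h t := (T x).1 * (acc c t).2 + - (T x).2 * (acc c t).1.
have ih : itv_integrable h.
  by apply: itv_integrableD; apply: itv_integrableZ;
    [exact: acc2_integrable|exact: acc1_integrable].
have k0 : 0 < k y by rewrite divr_gt0 ?invr_gt0// vspeed_gt0.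
have angk : angle (T x) (T y) <= k y * `|itv_integral h x y|.
  rewrite /k -mulrA ler_pdivlMl// mulrC.
  apply: le_trans (angle_mul_dot2_le (vtan_unit c x) (vtan_unit c y)) _.
  by rewrite cross2_vtan_increment// normrM (ger0_norm (x := _^-1)) 1?mulrC//
    invr_ge0 ltW// vspeed_gt0.
rewrite -energy_densityE -itv_integralZ// -itv_integralD; last 2 first.
- exact: energy_density_integrable.
- exact: itv_integrableZ.
apply: (@le_trans _ _ (2 * p * (k y * itv_integral (fun t => `|h t|) x y))).
  apply: ler_wpM2l; first by lra.
  apply: (le_trans angk); apply: ler_wpM2l; first exact: ltW.
  exact: norm_itv_integral.
rewrite mulrA -itv_integralZ; last exact: itv_integrable_norm.
apply: le_itv_integral.
- by apply: itv_integrableZ; exact: itv_integrable_norm.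
- apply: itv_integrableD; last exact: itv_integrableZ.
  exact: energy_density_integrable.
move=> t txy.
have -> : 2 * p * k y * `|h t| = 2 * p * `|k y * h t|.
  by rewrite normrM (gtr0_norm k0); ring.
(* The integrand with coefficients frozen at [x] and [y] is compared with its value at [t]; the
   remainder is linear in [acc], with coefficients smaller than [d]. *)
have -> : k y * h t = vcurv c t * v t +
    ((k y * (T x).1 - (T t).1 / v t) * (acc c t).2 -
     (k y * (T x).2 - (T t).2 / v t) * (acc c t).1).
  rewrite /h /vcurv /T /vtan /= -/v.
  by field; rewrite !v0.
set r := (X in `|_ + X|).
have rd : `|r| <= d * (`|(acc c t).1| + `|(acc c t).2|).
  rewrite (le_trans (ler_normB _ _))// !normrM mulrDr addrC.
  have := T1y t txy; have := T2y t txy; move: k1y k2y.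
  rewrite !ltr_norml => /andP[? ?] /andP[? ?] /andP[? ?] /andP[? ?].
  by apply: lerD; apply: ler_wpM2r => //; rewrite ler_norml; lra.
apply: (@le_trans _ _ (2 * p * (`|vcurv c t * v t| + `|r|))).
  by rewrite ler_wpM2l ?ler_normD//; lra.
rewrite mulrDr; apply: lerD.
  rewrite normrM (gtr0_norm (vspeed_gt0 c t)) mulrA ler_wpM2r//.
    exact: ltW (vspeed_gt0 c t).
  (* Young's inequality [2 p |k| <= k ^ 2 + p ^ 2]. *)
  have := sqr_ge0 (`|vcurv c t| - p).
  by rewrite -(real_normK (num_real (vcurv c t))); lra.
apply: (@le_trans _ _ (2 * p * d * (`|(acc c t).1| + `|(acc c t).2|))).
  by rewrite -[leRHS]mulrA ler_wpM2l//; lra.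
by rewrite ler_wpM2r// addr_ge0.
Unshelve. all: by end_near. Qed.

(** The local estimates add up because angles obey the triangle inequality while bending and length
    are additive. *)
Lemma angle_vtan_le c p x y : 0 <= p -> x <= y ->
  2 * p * angle (vtan c x) (vtan c y) <= vbend c x y + p ^+ 2 * vlen c x y.
Proof.
move=> p0 xy; rewrite -energy_densityE.
pose G z := itv_integral (fun t => (vcurv c t ^+ 2 + p ^+ 2) * vspeed c t) x z -
  2 * p * angle (vtan c x) (vtan c z).
pose n := fun t => `|(acc c t).1| + `|(acc c t).2|.
have n12 : itv_integrable n.
  by apply: itv_integrableD; apply: itv_integrable_norm;
    [exact: acc1_integrable|exact: acc2_integrable].
have unitT := vtan_unit c.
suff : G x <= G y.
  by rewrite /G itv_integral1 anglexx// mulr0 subrr subr_ge0.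
apply: (@le_of_near_right_increments _ G (itv_integral n x)) => //.
- have cI := itv_integral_continuous (@energy_density_integrable c p) xy.
  have cA : {within `[x, y],
      continuous (fun z => 2 * p * angle (vtan c x) (vtan c z))}.
    apply: continuous_subspaceT => z; apply: cvgM; first exact: cvg_cst.
    apply: angle_continuous => //.
      exact: vtan1_continuous.
    exact: vtan2_continuous.
  by move=> /= z; apply: cvgB; [exact: cI|exact: cA].
- exact: itv_integral_continuous.
- move=> z e /andP[xz zy] e0; near=> w.
  have zw : z <= w by near: w; exact: nbhs_right_ge.
  have : 2 * p * angle (vtan c z) (vtan c w) <= vbend c z w +
      p ^+ 2 * vlen c z w + e * itv_integral n z w.
    by near: w; exact: near_angle_vtan_le.
  rewrite -energy_densityE /G (itv_integral_split n12 xz zw).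
  rewrite (itv_integral_split (@energy_density_integrable c p) xz zw).
  have p2 : 0 <= 2 * p by lra.
  have := ler_wpM2l p2 (angle_triangle (unitT x) (unitT z) (unitT w)).
  lra.
Unshelve. all: by end_near. Qed.

End TangentVariation.

(** The discrete form of [(Phi th ^ 2)' <= k ^ 2 - w ^ 2 th ^ 2] for [Phi' = - (w ^ 2 + Phi ^ 2)].
    On a short arc, [W], [S] and [C] stand for bending, length and chord, [p], [p'] and [t], [t']
    for the values of [Phi] and [th] at the two ends, [z] for the cosine of [t], [P] for [pi], and
    [D] bounds all local errors. *)
Lemma calibration_increment (R : realFieldType) (W S C w p p' t t' D z P : R) :
  0 <= D -> 0 <= W -> 0 <= S -> 0 < P ->
  0 <= t <= P -> 0 <= t' <= P -> `|t' - t| <= D ->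
  (forall k, 2 * k * (t' - t) <= W + k ^+ 2 * S) ->
  p' - p <= (- (w ^+ 2 + p ^+ 2) + D) * S ->
  (z - D) * S <= C -> P ^+ 2 / 4 - P * z <= t ^+ 2 ->
  p' * t' ^+ 2 - p * t ^+ 2 <= W - w ^+ 2 * (P ^+ 2 / 4 * S - P * C) +
    D * (w ^+ 2 * P + 2 * P * (w ^+ 2 + p ^+ 2) + P ^+ 2 + `|p|) * (W + S).
Proof.
move=> D0 W0 S0 P0 /andP[t0 tP] /andP[t0' tP'] tD B HP HC Hz.
have w2 := sqr_ge0 w; have p2 := sqr_ge0 p.
have A1 := ler_wpM2r (sqr_ge0 t') HP.
have t2P : t' ^+ 2 <= P ^+ 2 by rewrite ler_sqr ?nnegrE// ltW.
have A2 : D * S * t' ^+ 2 <= D * S * P ^+ 2 by rewrite ler_wpM2l ?mulr_ge0.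
have tt : t ^+ 2 - 2 * P * D <= t' ^+ 2.
  by move: tD; rewrite ler_norml => /andP[tD1 tD2]; nra.
have wp0 : 0 <= (w ^+ 2 + p ^+ 2) * S by rewrite mulr_ge0// addr_ge0.
have A3 := ler_wpM2l wp0 tt.
(* With this slope the term [p ^ 2 t ^ 2] of Young's inequality cancels the one from the Riccati
   equation. *)
have A4 := B (p * t).
(* Slopes [1] and [-1] make the quadratic remainder [(t' - t) ^ 2] of order [D * (W + S)]. *)
have dt : 2 * `|t' - t| <= W + S.
  by have := B 1; have := B (-1); case: (ger0P (t' - t)) => ?; lra.
have dt2 : (t' - t) ^+ 2 <= D * ((W + S) / 2).
  by rewrite -real_normK ?num_real// expr2 ler_pM//; lra.
have A5 : p * (t' - t) ^+ 2 <= `|p| * (D * ((W + S) / 2)).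
  by apply: (le_trans (ler_wpM2r (sqr_ge0 _) (ler_norm p))); rewrite ler_wpM2l.
have A6 := ler_wpM2l (mulr_ge0 w2 (ltW P0)) HC.
have A7 := ler_wpM2l (mulr_ge0 w2 S0) Hz.
have A8 : 0 <= D * (w ^+ 2 * P + 2 * P * (w ^+ 2 + p ^+ 2) + P ^+ 2) * W.
  apply: mulr_ge0 => //; apply: mulr_ge0 => //.
  have h1 := mulr_ge0 w2 (ltW P0); have h2 := sqr_ge0 P.
  by have := mulr_ge0 (ltW P0) (addr_ge0 w2 p2); lra.
have A9 : 0 <= D * `|p| * (W + S) by rewrite !mulr_ge0 ?addr_ge0.
lra.
Qed.

(** * The calibrated lower bound for the bending energy of an arc *)

Section ArcBending.
Variable R : realType.
Implicit Types (c : velocity R) (a b m x y w d e s : R).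

(** The component along [q] of the displacement from [x] to [y], expressed by the velocity alone;
    [curve_velocity] links it to the curve. *)
Definition vchord c (q : R * R) x y :=
  itv_integral (fun t => dot2 q (vtan c t) * vspeed c t) x y.

Lemma vspeed_integrable c : itv_integrable (vspeed c).
Proof. exact: continuous_itv_integrable (@vspeed_continuous _ c). Qed.

Lemma chord_density_continuous c q :
  continuous (fun t => dot2 q (vtan c t) * vspeed c t).
Proof.
move=> x; apply: cvgM; last exact: vspeed_continuous.
by apply: dot2_continuous; [exact: vtan1_continuous|exact: vtan2_continuous].
Qed.

Lemma chord_density_integrable c q :
  itv_integrable (fun t => dot2 q (vtan c t) * vspeed c t).
Proof. exact: continuous_itv_integrable (@chord_density_continuous _ _). Qed.

Lemma vlen_ge0 c x y : 0 <= vlen c x y.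
Proof. by apply: itv_integral_ge0 => t _; exact: ltW (vspeed_gt0 c t). Qed.

Lemma vbend_ge0 c x y : 0 <= vbend c x y.
Proof.
apply: itv_integral_ge0 => t _; apply: mulr_ge0; first exact: sqr_ge0.
exact: ltW (vspeed_gt0 c t).
Qed.

Lemma vlen_split c x y z : x <= y -> y <= z ->
  vlen c x z = vlen c x y + vlen c y z.
Proof.
by move=> xy yz; apply: itv_integral_split => //; exact: vspeed_integrable.
Qed.

Lemma vbend_split c x y z : x <= y -> y <= z ->
  vbend c x z = vbend c x y + vbend c y z.
Proof.
by move=> xy yz; apply: itv_integral_split => //; exact: vcurv_sqr_integrable.
Qed.

Lemma vchord_split c q x y z : x <= y -> y <= z ->
  vchord c q x z = vchord c q x y + vchord c q y z.
Proof.
move=> xy yz; apply: itv_integral_split => //.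
exact: chord_density_integrable.
Qed.

Lemma vlen_gt0 c x y : x < y -> 0 < vlen c x y.
Proof.
move=> xy; apply: itv_integral_gt0 => //; first exact: vspeed_continuous.
by move=> t _; exact: vspeed_gt0.
Qed.

Lemma near_vlen_lt c x e : 0 < e -> \forall y \near x^'+, vlen c x y < e.
Proof.
move=> e0; have v0 := vspeed_gt0 c x.
have ev : 0 < e / (vspeed c x + 1) by rewrite divr_gt0//; lra.
near=> y.
have xy : x < y by near: y; exact: nbhs_right_gt.
have : `|vlen c x y - vspeed c x * (y - x)| <= 1 * (y - x).
  by near: y; apply: itv_integral_near => //; exact: vspeed_continuous.
rewrite ler_norml => /andP[_ H].
have : y - x < e / (vspeed c x + 1).
  rewrite ltrBlDl; near: y; apply: nbhs_right_lt; lra.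
rewrite ltr_pdivlMr; last by lra.
by lra.
Unshelve. all: by end_near. Qed.

Lemma near_chord_ge c q x d : 0 < d ->
  \forall y \near x^'+, (dot2 q (vtan c x) - d) * vlen c x y <= vchord c q x y.
Proof.
move=> d0.
have /cvgr_dist_lt /(_ _ d0) nd := @dot2_continuous _ (vtan c)
  (@vtan1_continuous _ c) (@vtan2_continuous _ c) q x.
near=> y.
have D : forall t, x <= t <= y ->
    `|dot2 q (vtan c x) - dot2 q (vtan c t)| < d.
  by near: y; exact: near_right_itv.
rewrite /vlen -itv_integralZ; last exact: vspeed_integrable.
apply: le_itv_integral.
- by apply: itv_integrableZ; exact: vspeed_integrable.
- exact: chord_density_integrable.
move=> t /D; rewrite ltr_norml => /andP[_ ?].
by rewrite ler_wpM2r//; [exact: ltW (vspeed_gt0 c t)|lra].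
Unshelve. all: by end_near. Qed.

Section Calibration.
Variables (c : velocity R) (a b w s0 : R) (q : R * R).
Hypothesis ab : a <= b.
Hypothesis w0 : 0 < w.
Hypothesis s0_itv : 0 <= s0 <= vlen c a b.
Hypothesis w_small : w * vlen c a b < pi / 2.
Hypothesis uq : unit2 q.

(* A solution of the Riccati equation [Phi' = - (w^2 + Phi^2)] vanishing at
   [s0]; composed with arclength it calibrates the bending energy. *)
Let Phi s := w * tan (w * (s0 - s)).
Let s y := vlen c a y.
Let th y := angle q (vtan c y).

Let s_itv y : a <= y <= b -> 0 <= s y <= vlen c a b.
Proof.
move=> /andP[ay yb]; rewrite /s vlen_ge0 (vlen_split _ ay yb) lerDl.
exact: vlen_ge0.
Qed.

(** The argument of [tan] is at most [w] times the length in modulus, so [w_small] keeps [Phi] away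
    from its poles. *)
Let cos_neq0 y : a <= y <= b -> cos (w * (s0 - s y)) != 0.
Proof.
move=> /s_itv /andP[sy0 sy1]; move: s0_itv => /andP[s00 s01].
apply/lt0r_neq0/cos_gt0_pihalf.
have : w * (s0 - s y) <= w * vlen c a b by rewrite ler_pM2l//; lra.
have : w * (s y - s0) <= w * vlen c a b by rewrite ler_pM2l//; lra.
move=> H1 H2; have := w_small => H3; apply/andP; split; lra.
Qed.

Let is_derive_Phi y : a <= y <= b ->
  is_derive (s y) 1 Phi (- (w ^+ 2 + Phi (s y) ^+ 2)).
Proof.
move=> yab; have c0 := cos_neq0 yab.
have dl : is_derive (s y) 1 (fun z => w * (s0 - z)) (- w).
  by apply: is_derive_eq; rewrite /GRing.scale /=; ring.
have dt := is_derive_tan c0.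
have dc := @is_derive1_comp _ tan (fun z => w * (s0 - z)) (s y) _ _ dt dl.
have : is_derive (s y) 1 (fun z => w * (tan \o (fun z => w * (s0 - z))) z)
   (w * (- w * (cos (w * (s0 - s y))) ^-2)).
  by apply: is_derive_eq; rewrite /GRing.scale /=; ring.
move=> H; apply: (is_derive_eq H).
by rewrite (cos2_tan2 c0) /Phi; ring.
Qed.

(** Bending minus its expected lower bound, corrected by the boundary term of the calibration; that
    it does not decrease is the whole estimate. *)
Let G y := vbend c a y - w ^+ 2 * (pi ^+ 2 / 4 * s y - pi * vchord c q a y) -
  Phi (s y) * th y ^+ 2.

Lemma calibration_step x e : a <= x < b -> 0 < e ->
  \forall y \near x^'+,
    G x - G y <= e * ((vbend c a y + s y) - (vbend c a x + s x)).
Proof.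
move=> /andP[ax xb] e0; set p := Phi (s x).
have pi0 : 0 < pi :> R := pi_gt0 R.
(* [K] is the error coefficient in [calibration_increment]; dividing [e] by it makes the total error
   [e * (W + S)]. *)
pose K := w ^+ 2 * pi + 2 * pi * (w ^+ 2 + p ^+ 2) + pi ^+ 2 + `|p|.
have K0 : 0 < K.
  have h1 : 0 < pi ^+ 2 :> R by rewrite exprn_gt0.
  have h2 : 0 <= w ^+ 2 * pi by rewrite mulr_ge0 ?sqr_ge0// ltW.
  have h3 : 0 <= 2 * pi * (w ^+ 2 + p ^+ 2).
    by apply: mulr_ge0; [lra|rewrite addr_ge0 ?sqr_ge0].
  by have := normr_ge0 p; rewrite /K; lra.
pose d := e / K; have d0 : 0 < d by rewrite divr_gt0.
have dK : d * K = e by rewrite divfK// lt0r_neq0.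
have xab : a <= x <= b by rewrite ax ltW.
have /is_derive1_caratheodory[g [gE gc gx]] := is_derive_Phi xab.
have /cvgr_dist_lt/(_ _ d0)/nbhs_ballP[r /= r0 gr] := gc.
near=> y.
have xy : x < y by near: y; exact: nbhs_right_gt.
have ay : a <= y by rewrite (le_trans ax)// ltW.
have sE : s y = s x + vlen c x y by apply: vlen_split => //; exact: ltW.
have WE : vbend c a y = vbend c a x + vbend c x y.
  by apply: vbend_split => //; exact: ltW.
have CE : vchord c q a y = vchord c q a x + vchord c q x y.
  by apply: vchord_split => //; exact: ltW.
have C1 : (dot2 q (vtan c x) - d) * vlen c x y <= vchord c q x y.
  by near: y; exact: near_chord_ge.
have th1 : angle (vtan c x) (vtan c y) < d.
  near: y; apply: cvg_within; apply: near_angle_lt => //.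
  - exact: vtan1_continuous.
  - exact: vtan2_continuous.
  - by move=> z; exact: vtan_unit.
have sr : vlen c x y < r by near: y; exact: near_vlen_lt.
have P1 : Phi (s y) - p <= (- (w ^+ 2 + p ^+ 2) + d) * vlen c x y.
  rewrite gE {2}sE (addrC (s x)) addrK ler_wpM2r ?vlen_ge0//.
  have : ball (s x) r (s y).
    by rewrite /ball /= sE opprD addNKr normrN ger0_norm ?vlen_ge0.
  by move=> /gr; rewrite gx ltr_norml -/p; lra.
have unitT := vtan_unit c.
have thD : `|th y - th x| <= angle (vtan c x) (vtan c y).
  have := angle_triangle uq (unitT x) (unitT y).
  have := angle_triangle uq (unitT y) (unitT x); rewrite (angleC (vtan c y)).
  by rewrite ler_norml /th; lra.
have B k : 2 * k * (th y - th x) <= vbend c x y + k ^+ 2 * vlen c x y.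
  have := @angle_vtan_le _ c `|k| x y (normr_ge0 _) (ltW xy).
  rewrite real_normK ?num_real//; apply: le_trans.
  rewrite (le_trans (ler_norm _))// !normrM normr_nat.
  by rewrite ler_wpM2l// mulr_ge0.
have thx0 : 0 <= th x by exact: angle_ge0.
have thxp : th x <= pi by exact: angle_le_pi.
have thy0 : 0 <= th y by exact: angle_ge0.
have thyp : th y <= pi by exact: angle_le_pi.
have H5 : pi ^+ 2 / 4 - pi * dot2 q (vtan c x) <= th x ^+ 2.
  by rewrite -cos_angle//; apply: sqr_ge_cos; rewrite thx0.
have L0 := vlen_ge0 c x y; have W0 := vbend_ge0 c x y.
have t2 : `|th y - th x| <= d by rewrite (le_trans thD)// ltW.
have := @calibration_increment _ _ _ _ w p (Phi (s y)) _ _ d _ _ (ltW d0) W0 L0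
  pi0 (introT andP (conj thx0 thxp)) (introT andP (conj thy0 thyp)) t2
  B P1 C1 H5.
rewrite -/K dK /G WE CE sE -/p; lra.
Unshelve. all: by end_near. Qed.

Lemma calibration : G a <= G b.
Proof.
apply: (@le_of_near_right_increments _ G (fun y => vbend c a y + s y)) => //.
- apply/subspace_continuousP => y yab.
  have cs := itv_integral_continuous (@vspeed_integrable c) ab.
  have cW := itv_integral_continuous (@vcurv_sqr_integrable _ c) ab.
  have cC := itv_integral_continuous (@chord_density_integrable c q) ab.
  move/subspace_continuousP/(_ y yab) : cs => cs.
  move/subspace_continuousP/(_ y yab) : cW => cW.
  move/subspace_continuousP/(_ y yab) : cC => cC.
  move: yab; rewrite /= in_itv /= => yab.
  have cth : th z @[z --> within `[a, b] (nbhs y)] --> th y.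
    apply: cvg_within_filter; apply: angle_continuous => //.
    + exact: vtan1_continuous.
    + exact: vtan2_continuous.
    + exact: vtan_unit.
  have cPhi : (Phi \o s) z @[z --> within `[a, b] (nbhs y)] --> Phi (s y).
    apply: (cvg_comp _ _ cs).
    apply: differentiable_continuous; apply/derivable1_diffP.
    exact: (@ex_derive _ _ _ _ _ _ _ (is_derive_Phi yab)).
  apply: cvgB.
    apply: cvgB; first exact: cW.
    apply: cvgM; first exact: cvg_cst.
    by apply: cvgB; apply: cvgM; [exact: cvg_cst|exact: cs|exact: cvg_cst|
      exact: cC].
  by apply: cvgM; [exact: cPhi|rewrite expr2; apply: cvgM; exact: cth].
- move=> /= y; apply: cvgD.
    exact: itv_integral_continuous (@vcurv_sqr_integrable _ c) ab y.
  exact: itv_integral_continuous (@vspeed_integrable c) ab y.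
- by move=> x e xab e0; exact: calibration_step.
Qed.

End Calibration.
End ArcBending.

(** * Bending against the chord, and Fenchel's theorem for two arcs *)

Section ArcsAndClosedCurves.
Variable R : realType.
Implicit Types (c : velocity R) (a b x y w p : R).

(** The weights [0] and [1] halve the length; weights depending on [p] halve the quantity used for
    Fenchel's theorem. *)
Lemma energy_midpoint c a b k k' : a <= b -> 0 <= k -> 0 <= k' ->
  exists2 m, a <= m <= b &
    k * vbend c a m + k' * vlen c a m = (k * vbend c a b + k' * vlen c a b) / 2.
Proof.
move=> ab k0 k0'; pose f x := k * vbend c a x + k' * vlen c a x.
have fa : f a = 0 by rewrite /f /vbend /vlen !itv_integral1; ring.
have fb : 0 <= f b by rewrite addr_ge0 ?mulr_ge0 ?vbend_ge0 ?vlen_ge0.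
have [||m mab fm] := @IVT _ f a b (f b / 2) ab.
- move=> /= y; apply: cvgD; apply: cvgM; try exact: cvg_cst.
    exact: itv_integral_continuous (@vcurv_sqr_integrable _ c) ab y.
  exact: itv_integral_continuous (@vspeed_integrable _ c) ab y.
- by rewrite fa; apply/andP; split; rewrite ?ge_min ?le_max; apply/orP;
    [left|right]; lra.
- by exists m; [rewrite in_itv in mab|].
Qed.

(* The tangent is compared with the one at the midpoint in arclength. *)
Lemma vbend_ge_chord c a b w (X : R) : a <= b -> 0 < w -> w * vlen c a b < pi ->
  (forall q, unit2 q -> vchord c q a b <= X) ->
  w ^+ 2 * (pi ^+ 2 / 4 * vlen c a b - pi * X) <= vbend c a b.
Proof.
move=> ab w0 wl qX.
have [m /andP[am mb]] := @energy_midpoint c a b 0 1 ab (lexx _) ler01.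
rewrite !mul0r !mul1r !add0r => lm.
have ls := vlen_split c am mb.
have uq := vtan_unit c m.
(* The term [Phi * th ^ 2] must vanish at both ends of each half: [th] is zero at [m], and [s0] is
   chosen so that [Phi] is zero at the other end. Halving the arc is what allows [w * vlen c a b] up
   to [pi]. *)
have := @calibration _ c a m w 0 _ am w0.
rewrite lexx vlen_ge0 => /(_ _ isT) H1.
have {H1} := H1 _ _ uq.
have := @calibration _ c m b w (vlen c m b) _ mb w0.
rewrite lexx vlen_ge0 => /(_ _ isT) H2.
have {H2} := H2 _ _ uq.
have := qX _ uq.
rewrite (vchord_split c _ am mb) (vbend_split c am mb).
have I1 x : vlen c x x = 0 by exact: itv_integral1.
have I2 x : vbend c x x = 0 by exact: itv_integral1.
have I3 q x : vchord c q x x = 0 by exact: itv_integral1.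
rewrite !I1 !I2 !I3 (anglexx uq) !subrr !mulr0 tan0.
rewrite !mulr0 !mul0r expr0n /= !mulr0.
move=> HX H2 H1.
have w2 : 0 <= w ^+ 2 * pi by rewrite mulr_ge0 ?sqr_ge0// pi_ge0.
have {}HX := ler_wpM2l w2 HX.
have wl1 : w * vlen c a m = w * vlen c a b / 2 by rewrite lm mulrA.
have wl2 : w * vlen c m b = w * vlen c a b / 2.
  by rewrite (_ : vlen c m b = vlen c a b / 2) ?mulrA//; lra.
have {}H2 := H2 ltac:(lra); have {}H1 := H1 ltac:(lra).
by rewrite ls; lra.
Qed.

Section Fenchel.
Variable p : R.
Hypothesis p0 : 0 < p.

(** By Young's inequality an upper bound for total curvature. Additivity and domination of the
    tangent angles are all that Fenchel's argument needs. *)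
Let tv c x y := (vbend c x y + p ^+ 2 * vlen c x y) / (2 * p).

Let tv_split c x y z : x <= y -> y <= z -> tv c x z = tv c x y + tv c y z.
Proof.
move=> xy yz; rewrite /tv (vbend_split c xy yz) (vlen_split c xy yz); lra.
Qed.

Let angle_le_tv c x y : x <= y -> angle (vtan c x) (vtan c y) <= tv c x y.
Proof.
move=> xy; rewrite /tv ler_pdivlMr ?mulr_gt0// mulrC.
by apply: angle_vtan_le => //; exact: ltW.
Qed.

Lemma cosD_gt0 (t t' : R) : 0 <= t -> 0 <= t' -> t + t' < pi ->
  0 < cos t + cos t'.
Proof.
move=> t0 t0' lt_pi; have lt_t : t < pi - t' by rewrite ltrBrDr.
suff : cos (pi - t') < cos t.
  by rewrite cosB cospi sinpi mul0r addr0 mulN1r -subr_gt0 opprK.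
have le_pi : pi - t' <= pi by rewrite gerBl.
rewrite ltr_cos// in_itv /= ?t0 ?le_pi ?andbT//=.
  exact: ltW (lt_le_trans lt_t le_pi).
exact: le_trans t0 (ltW lt_t).
Qed.

Lemma unit2N (q : R * R) : unit2 q -> unit2 (- q).
Proof. by rewrite /unit2 /= !sqrrN. Qed.

Lemma angleNN (q r : R * R) : angle (- q) (- r) = angle q r.
Proof. by rewrite /angle /dot2 /= !mulrNN. Qed.

(** The closed curve follows [c] and returns along [c'], with tangent opposite to that of [c']. Its
    two parts between [m] and [m'] each turn by less than [2 * pi / 3], plus [pi / 3] at a junction.
    A tangent of [c] thus makes angles of sum below [pi] with the two chosen tangents, and its
    cosines with them have positive sum. *)
Let half_positive c c' a b m m' : a <= m <= b -> a <= m' <= b ->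
  tv c a m = tv c a b / 2 -> tv c' a m' = tv c' a b / 2 ->
  angle (vtan c a) (- vtan c' a) <= pi / 3 ->
  angle (vtan c b) (- vtan c' b) <= pi / 3 ->
  tv c a b + tv c' a b < 4 * pi / 3 ->
  forall x, a <= x <= b ->
  0 < dot2 (vtan c m - vtan c' m') (vtan c x).
Proof.
move=> /andP[am mb] /andP[am' m'b] hm hm' ja jb tot x /andP[ax xb].
have u z := vtan_unit c z; have u' z := unit2N (vtan_unit c' z).
have sm := tv_split c am mb; have sm' := tv_split c' am' m'b.
have sx := tv_split c ax xb.
suff : angle (vtan c m) (vtan c x) + angle (vtan c x) (- vtan c' m') < pi.
  set t1 := angle _ _; set t2 := angle _ _ => tlt.
  have -> : dot2 (vtan c m - vtan c' m') (vtan c x) = cos t1 + cos t2.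
    by rewrite !cos_angle// /dot2 /=; ring.
  by apply: cosD_gt0 => //; exact: angle_ge0.
have [xm|/ltW mx] := leP x m.
- have s1 := tv_split c ax xm.
  have := angle_le_tv c xm; rewrite angleC => h1.
  have := angle_le_tv c ax; rewrite angleC => h2.
  have h3 := angle_le_tv c' am'; rewrite -angleNN in h3.
  have t1 := angle_triangle (u x) (u a) (u' m').
  have t2 := angle_triangle (u a) (u' a) (u' m').
  move: hm hm' ja tot sm sm' s1 h1 h2 h3 t1 t2; clear.
  by do 8! move: (tv _ _ _) => ?; do 5! move: (angle _ _) => ?; lra.
- have s1 := tv_split c mx xb.
  have h1 := angle_le_tv c mx.
  have h2 := angle_le_tv c xb.
  have := angle_le_tv c' m'b; rewrite -angleNN angleC => h3.
  have t1 := angle_triangle (u x) (u b) (u' m').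
  have t2 := angle_triangle (u b) (u' b) (u' m').
  move: hm hm' jb tot sm sm' sx s1 h1 h2 h3 t1 t2; clear.
  by do 9! move: (tv _ _ _) => ?; do 5! move: (angle _ _) => ?; lra.
Qed.

(* Fenchel's theorem for the closed curve made of two arcs meeting at interior
   angles of at least [2 pi / 3]: were its total curvature too small, all its
   tangents would make acute angles with the sum of two opposite ones. *)
Lemma fenchel_two_arcs c c' a b : a < b ->
  angle (vtan c a) (- vtan c' a) <= pi / 3 ->
  angle (vtan c b) (- vtan c' b) <= pi / 3 ->
  (forall q, vchord c q a b = vchord c' q a b) ->
  8 * pi / 3 * p <= vbend c a b + vbend c' a b +
    p ^+ 2 * (vlen c a b + vlen c' a b).
Proof.
move=> ab ja jb chord; rewrite leNgt; apply/negP => lt_tot.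
have tot : tv c a b + tv c' a b < 4 * pi / 3.
  by rewrite /tv -mulrDl ltr_pdivrMr ?mulr_gt0//; lra.
have mid d : exists2 m, a <= m <= b & tv d a m = tv d a b / 2.
  have [||m mab hm] := @energy_midpoint d a b (2 * p)^-1 (p ^+ 2 / (2 * p))
    (ltW ab).
  - by rewrite invr_ge0 mulr_ge0// ltW.
  - by rewrite divr_ge0 ?sqr_ge0// mulr_ge0// ltW.
  - exists m => //; move: hm; rewrite /tv; set i := (2 * p)^-1; lra.
have [m mab hm] := mid c; have [m' mab' hm'] := mid c'.
have P1 := half_positive mab mab' hm hm' ja jb tot.
have ja' : angle (vtan c' a) (- vtan c a) <= pi / 3.
  by rewrite angleC -angleNN opprK.
have jb' : angle (vtan c' b) (- vtan c b) <= pi / 3.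
  by rewrite angleC -angleNN opprK.
rewrite addrC in tot.
have P2 := half_positive mab' mab hm' hm ja' jb' tot.
have pos d q : (forall x, a <= x <= b -> 0 < dot2 q (vtan d x)) ->
    0 < vchord d q a b.
  move=> dq; apply: itv_integral_gt0 => //.
    exact: chord_density_continuous.
  by move=> t tab; apply: mulr_gt0; [exact: dq|exact: vspeed_gt0].
have := pos _ _ P1; have := pos _ _ P2.
(* Exchanging the arcs reverses the direction, so the common chord would have both a positive and a
   negative component along it. *)
rewrite chord -opprB.
have -> : vchord c' (- (vtan c m - vtan c' m')) a b =
    - vchord c' (vtan c m - vtan c' m') a b.
  rewrite /vchord -[RHS]mulN1r -itv_integralZ; last first.
    exact: chord_density_integrable.
  by apply: eq_itv_integral => t _; rewrite /dot2 /=; ring.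
lra.
Qed.

End Fenchel.

(** As [u2 + u3] has norm one, [dot2 u2 u3] is -1 / 2. The angle is the exterior one of the closed
    curve at a junction. *)
Lemma angle_120 (u1 u2 u3 : R * R) : unit2 u1 -> unit2 u2 -> unit2 u3 ->
  u1 + u2 + u3 = 0 -> angle u2 (- u3) = pi / 3.
Proof.
move=> h1 h2 h3 s0.
have e1 : u1.1 = - (u2.1 + u3.1).
  by have := congr1 fst s0; rewrite /= => ?; lra.
have e2 : u1.2 = - (u2.2 + u3.2).
  by have := congr1 snd s0; rewrite /= => ?; lra.
have d : dot2 u2 (- u3) = 1 / 2.
  by move: h1 h2 h3; rewrite /unit2 e1 e2 /dot2 /=; lra.
have p0 := pi_gt0 R.
by rewrite /angle d -cos_pithird cosK// in_itv /=; apply/andP; split; lra.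
Qed.

End ArcsAndClosedCurves.

(** * Numerical comparison with the double bubble *)

Section NetworkBound.
Variable R : realType.
Implicit Types (c : velocity R) (a b x y w p : R).

(* The energy of the standard double bubble of radius [9 / 10]. *)
Definition bubble_energy : R :=
  8 * (pi / 3) * (10 / 9 + 9 / 10) + 9 / 10 * Num.sqrt 3.

Definition venergy c x y := vbend c x y + vlen c x y.

Lemma sqrt3_lt : Num.sqrt 3 < 26 / 15 :> R.
Proof.
have s3 : Num.sqrt 3 ^+ 2 = 3 :> R by rewrite sqr_sqrtr.
have s0 := sqrtr_ge0 (3 : R).
by rewrite ltNge; apply/negP => s26; nra.
Qed.

Lemma vchord_le_vlen c q x y : unit2 q -> vchord c q x y <= vlen c x y.
Proof.
move=> uq; apply: le_itv_integral.
- exact: chord_density_integrable.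
- exact: vspeed_integrable.
- move=> t _; have /andP[_ d1] := dot2_bound uq (vtan_unit c t).
  by rewrite ler_piMl// ltW// vspeed_gt0.
Qed.

Lemma loop_energy c a b : a < b -> (forall q, vchord c q a b = 0) ->
  31 / 10 * pi <= venergy c a b.
Proof.
move=> ab loop; have l0 := vlen_gt0 c ab; set l := vlen c a b in l0.
have := @vbend_ge_chord _ c a b (31 / 10 / l) 0 (ltW ab).
rewrite -/l divfK ?lt0r_neq0// => /(_ _ (pi_gt31 R)).
rewrite mulr0 subr0 /venergy -/l => /(_ ltac:(by rewrite divr_gt0//; lra)) H.
have {}H := H (fun q _ => ltac:(by rewrite loop)).
have E : (31 / 10 / l) ^+ 2 * (pi ^+ 2 / 4 * l) = (31 / 20 * pi) ^+ 2 / l.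
  by field; rewrite lt0r_neq0.
rewrite E in H.
(* Arithmetic-geometric mean inequality for the two terms. *)
suff : 31 / 10 * pi <= (31 / 20 * pi) ^+ 2 / l + l by lra.
rewrite -(ler_pM2r l0) [leRHS]mulrDl divfK ?lt0r_neq0//.
have := sqr_ge0 (31 / 20 * pi - l); lra.
Qed.

(** With [A = 31 / 20 * pi], the energy is at least [A ^ 2 / l + l = 2 A + (A - l) ^ 2 / l], less a
    defect [B / l ^ 2] caused by the chord. The length bound [3 / 2] excludes short arcs, for which
    the defect would dominate. *)
Lemma long_arc_energy c (X : R) : X <= 1 / 3 ->
  (forall q, unit2 q -> vchord c q 0 1 <= X) -> 3 / 2 <= vlen c 0 1 ->
  bubble_energy - 31 / 10 * pi < venergy c 0 1.
Proof.
move=> X3 chord; set l := vlen c 0 1 => l32.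
have l0 : 0 < l by lra.
have pg := pi_gt31 R; have pl := pi_lt33 R; have s3 := sqrt3_lt.
have := @vbend_ge_chord _ c 0 1 (31 / 10 / l) X ler01.
rewrite -/l divfK ?lt0r_neq0// => /(_ _ (pi_gt31 R) chord).
rewrite /venergy -/l => /(_ ltac:(by rewrite divr_gt0//; lra)) H.
pose B := 961 / 100 * (pi / 3) : R.
have {H} : (31 / 20 * pi) ^+ 2 / l - B / l ^+ 2 <= vbend c 0 1.
  apply: le_trans H; rewrite -subr_ge0.
  have -> : (31 / 10 / l) ^+ 2 * (pi ^+ 2 / 4 * l - pi * X) -
      ((31 / 20 * pi) ^+ 2 / l - B / l ^+ 2) =
      961 / 100 * pi * (1 / 3 - X) * l^-1 ^+ 2.
    by rewrite /B; field; rewrite lt0r_neq0.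
  apply: mulr_ge0; last by rewrite sqr_ge0.
  by apply: mulr_ge0; lra.
suff : bubble_energy - 31 / 10 * pi < (31 / 20 * pi) ^+ 2 / l - B / l ^+ 2 + l.
  lra.
(* The two sides are about 8.67 and 8.71, so the defect may exceed the square term by
   [103 / 100]. *)
have H1 : bubble_energy - 31 / 10 * pi < 31 / 10 * pi - 103 / 100.
  by rewrite /bubble_energy; lra.
apply: (lt_le_trans H1).
rewrite -(ler_pM2r (exprn_gt0 2 l0)).
have -> : ((31 / 20 * pi) ^+ 2 / l - B / l ^+ 2 + l) * l ^+ 2 =
    (31 / 20 * pi) ^+ 2 * l - B + l ^+ 3.
  by field; rewrite lt0r_neq0.
suff : 0 <= l * (31 / 20 * pi - l) ^+ 2 + 103 / 100 * l ^+ 2 - B by lra.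
have Bl : B <= 1058 / 100 by rewrite /B; lra.
have h0 : 0 <= l * (31 / 20 * pi - l) ^+ 2 by rewrite mulr_ge0 ?sqr_ge0// ltW.
(* From 33 / 10 on, [103 / 100 * l ^ 2] alone exceeds [B]; below, [l] is far from [31 / 20 * pi],
   which is at least 961 / 200. *)
have [l33|l33] := leP (33 / 10) l; first by nra.
have h1 : (961 / 200 - l) ^+ 2 <= (31 / 20 * pi - l) ^+ 2.
  by rewrite ler_sqr ?nnegrE; lra.
have h2 := ler_wpM2l (ltW l0) h1.
have : 0 <= (l - 3 / 2) * (33 / 10 - l) * l.
  by rewrite mulr_ge0 ?(ltW l0)// mulr_ge0 ?subr_ge0// ltW.
nra.
Qed.

Lemma network_energy_loop c c' c'' a b : 0 <= a -> a < b -> b <= 1 ->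
  (forall q, vchord c q a b = 0) ->
  (forall q, vchord c' q 0 1 = vchord c q 0 1) ->
  (forall q, vchord c'' q 0 1 = vchord c q 0 1) ->
  vtan c 0 + vtan c' 0 + vtan c'' 0 = 0 ->
  vtan c 1 + vtan c' 1 + vtan c'' 1 = 0 ->
  bubble_energy < venergy c 0 1 + venergy c' 0 1 + venergy c'' 0 1.
Proof.
move=> a0 ab b1 loop chord' chord'' junc0 junc1.
have u := @vtan_unit R.
have pg := pi_gt31 R; have pl := pi_lt33 R; have s3 := sqrt3_lt.
pose d := vlen c 0 a + vlen c b 1.
have a1 : a <= 1 by rewrite (le_trans _ b1)// ltW.
(* The loop contributes nothing to the displacement, so the junctions are at distance at most
   [d]. *)
have chord_d q : unit2 q -> vchord c q 0 1 <= d.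
  move=> uq; rewrite (vchord_split c q a0 a1) (vchord_split c q (ltW ab) b1).
  by rewrite loop add0r /d lerD// vchord_le_vlen.
have Ec : 31 / 10 * pi + d <= venergy c 0 1.
  have := loop_energy ab loop; rewrite /venergy /d.
  rewrite (vlen_split c a0 a1) (vlen_split c (ltW ab) b1).
  rewrite (vbend_split c a0 a1) (vbend_split c (ltW ab) b1).
  have := vbend_ge0 c 0 a; have := vbend_ge0 c b 1; lra.
have F p : 0 < p -> 8 * pi / 3 * p <= vbend c' 0 1 + vbend c'' 0 1 +
    p ^+ 2 * (vlen c' 0 1 + vlen c'' 0 1).
  move=> p0; apply: fenchel_two_arcs => //.
  - by rewrite (angle_120 (u c 0) (u c' 0) (u c'' 0)).
  - by rewrite (angle_120 (u c 1) (u c' 1) (u c'' 1)).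
  - by move=> q; rewrite chord' chord''.
have E0 e x y : 0 <= venergy e x y by rewrite addr_ge0 ?vbend_ge0 ?vlen_ge0.
have d0 : 0 <= d by rewrite addr_ge0 ?vlen_ge0.
have [d3|/ltW d3] := leP (1 / 3) d.
  have := F 1 ltr01; move: Ec; rewrite /venergy /bubble_energy expr1n; lra.
have [l3|l3] := leP (vlen c' 0 1 + vlen c'' 0 1) 3.
  (* 7 / 5 is close to [4 * pi / 9], which maximizes [8 * pi / 3 * p - 3 * (p ^ 2 - 1)], the energy
     bound left for total length at most 3. *)
  have := F (7 / 5) ltac:(lra); move: Ec; rewrite /venergy /bubble_energy; lra.
have E' := E0 c' 0 1; have E'' := E0 c'' 0 1.
(* One of the two curves has length at least 3 / 2. It and the loop already exceed the bubble, and
   the third curve has nonnegative energy. *)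
have [l'|l'] := leP (3 / 2) (vlen c' 0 1).
  have : forall q, unit2 q -> vchord c' q 0 1 <= d.
    by move=> q uq; rewrite chord' chord_d.
  by move=> /(long_arc_energy d3)/(_ l'); lra.
have : forall q, unit2 q -> vchord c'' q 0 1 <= d.
  by move=> q uq; rewrite chord'' chord_d.
by move=> /(long_arc_energy d3)/(_ ltac:(lra)); lra.
Qed.

End NetworkBound.

(** * Continuously differentiable cutoffs made of quadratic splines *)

Section SmoothSteps.
Variable R : realType.
Implicit Types (a b d t x y e : R).

Definition pospart t : R := Num.max t 0.

Lemma pospart_continuous : continuous pospart.
Proof.
move=> t; apply: (@continuous_max _ _ (fun x => x) (fun=> 0)).
  exact: cvg_id.
exact: cvg_cst.
Qed.

Lemma is_derive_pospart_sqr t :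
  is_derive t 1 (fun x => pospart x ^+ 2) (2 * pospart t).
Proof.
have [t0|t0|->] := ltrgt0P t.
- apply: (@near_eq_is_derive _ _ _ (fun x => x ^+ 2)).
    near=> x; rewrite /pospart max_l// ltW//; near: x; exact: lt_nbhsr.
  by apply: is_derive_eq; rewrite /pospart max_l ?ltW// /GRing.scale /=; ring.
- apply: (@near_eq_is_derive _ _ _ (fun=> 0)).
    near=> x; rewrite /pospart max_r ?expr0n// ltW//; near: x; exact: lt_nbhsl.
  by apply: is_derive_eq; rewrite /pospart max_r ?ltW// mulr0.
- apply/is_derive1_caratheodory; exists pospart; split.
  + move=> z; rewrite /pospart maxxx; case: (leP z 0) => z0; ring.
  + exact: pospart_continuous.
  + by rewrite /pospart maxxx mulr0.
Unshelve. all: by end_near. Qed.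

(* A [C^1] transition from [0] to [1] on [[0, d]]: twice the second difference
   of the square of the positive part. *)
Definition smooth_step d t : R := 2 * (pospart (t / d) ^+ 2 -
  2 * pospart (t / d - 1 / 2) ^+ 2 + pospart (t / d - 1) ^+ 2).

Definition dsmooth_step d t : R := 4 / d * (pospart (t / d) -
  2 * pospart (t / d - 1 / 2) + pospart (t / d - 1)).

Lemma is_derive_smooth_step d a t : d != 0 ->
  is_derive t 1 (fun x => smooth_step d (x - a)) (dsmooth_step d (t - a)).
Proof.
move=> d0.
have H k : is_derive t 1 (fun x => pospart ((x - a) / d - k) ^+ 2)
    (2 * pospart ((t - a) / d - k) / d).
  have dl : is_derive t 1 (fun x => (x - a) / d - k) d^-1.
    by apply: is_derive_eq; rewrite /GRing.scale /=; ring.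
  exact: (is_derive1_comp (is_derive_pospart_sqr _) dl).
have H0 := H 0; rewrite subr0 in H0.
have {}H0 : is_derive t 1 (fun x => pospart ((x - a) / d) ^+ 2)
    (2 * pospart ((t - a) / d) / d).
  by move: H0; under eq_fun do rewrite subr0.
have H1 := H (1 / 2); have H2 := H 1.
have := is_deriveZ 2 (is_deriveD (is_deriveB H0 (is_deriveZ 2 H1)) H2).
move=> HH; apply: (is_derive_eq HH).
by rewrite /dsmooth_step /GRing.scale /=; field.
Qed.

Lemma dsmooth_step_continuous d a :
  continuous (fun x => dsmooth_step d (x - a)).
Proof.
have H k : continuous (fun x => pospart ((x - a) / d - k)).
  move=> x; apply: (@continuous_comp _ _ _ (fun y => (y - a) / d - k) pospart);
    last exact: pospart_continuous.
  apply: cvgB; last exact: cvg_cst.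
  by apply: cvgM; [apply: cvgB; [exact: cvg_id|exact: cvg_cst]|exact: cvg_cst].
have H0 : continuous (fun x => pospart ((x - a) / d)).
  by have := H 0; under eq_fun do rewrite subr0.
move=> x; apply: cvgM; first exact: cvg_cst.
apply: cvgD; last exact: H.
by apply: cvgB; [exact: H0|apply: cvgM; [exact: cvg_cst|exact: H]].
Qed.

Lemma smooth_step_le0 d t : 0 < d -> t <= 0 -> smooth_step d t = 0.
Proof.
move=> d0 t0; have td : t / d <= 0 by rewrite ler_pdivrMr// mul0r.
by rewrite /smooth_step /pospart !max_r; [ring|lra..].
Qed.

Lemma smooth_step_ge d t : 0 < d -> d <= t -> smooth_step d t = 1.
Proof.
move=> d0 t0; have td : 1 <= t / d by rewrite ler_pdivlMr// mul1r.
rewrite /smooth_step /pospart; set z := t / d in td *.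
by rewrite !max_l; [field|lra..].
Qed.

Lemma smooth_step_itv d t : 0 < d -> 0 <= smooth_step d t <= 1.
Proof.
move=> d0; rewrite /smooth_step /pospart; set z := t / d.
case: (leP z 0) => z0; case: (leP (z - 1 / 2) 0) => z1;
  case: (leP (z - 1) 0) => z2; apply/andP; split; nra.
Qed.

Lemma dsmooth_step_le0 d t : 0 < d -> t <= 0 -> dsmooth_step d t = 0.
Proof.
move=> d0 t0; have td : t / d <= 0 by rewrite ler_pdivrMr// mul0r.
by rewrite /dsmooth_step /pospart !max_r; [ring|lra..].
Qed.

Lemma dsmooth_step_ge d t : 0 < d -> d <= t -> dsmooth_step d t = 0.
Proof.
move=> d0 t0; have td : 1 <= t / d by rewrite ler_pdivlMr// mul1r.
rewrite /dsmooth_step /pospart; set z := t / d in td *.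
by rewrite !max_l; [field; rewrite lt0r_neq0|lra..].
Qed.

Lemma dsmooth_step_ge0 d t : 0 < d -> 0 <= dsmooth_step d t.
Proof.
move=> d0; apply: mulr_ge0; first by rewrite divr_ge0// ltW.
rewrite /pospart; set z := t / d.
case: (leP z 0) => z0; case: (leP (z - 1 / 2) 0) => z1;
  case: (leP (z - 1) 0) => z2; lra.
Qed.

Lemma itv_integral_derive (F f : R -> R) x y : x <= y ->
  (forall t, is_derive t 1 F (f t)) -> continuous f ->
  itv_integral f x y = F y - F x.
Proof.
rewrite le_eqVlt => /predU1P[->|xy] dF cf.
  by rewrite itv_integral1 subrr.
have cF : continuous F.
  move=> t; apply: differentiable_continuous; apply/derivable1_diffP.
  exact: (@ex_derive _ _ _ _ _ _ _ (dF t)).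
rewrite /itv_integral /Rintegral (@continuous_FTC2 _ f F x y xy).
- by [].
- exact: continuous_subspaceT.
- split.
  + by move=> t _; exact: (@ex_derive _ _ _ _ _ _ _ (dF t)).
  + apply: cvg_at_right_filter; exact: cF.
  + apply: cvg_at_left_filter; exact: cF.
- by move=> t _; rewrite derive1E; exact: (@derive_val _ _ _ _ _ _ _ (dF t)).
Qed.

End SmoothSteps.

(** * From weak derivatives to increments *)

Section WeakDerivatives.
Variable R : realType.
Implicit Types (U g phi : R -> R) (a b d t x y e : R).

Lemma itv_integral_small f x e : itv_integrable f -> 0 < e ->
  exists2 d, 0 < d & forall y, x <= y < x + d -> `|itv_integral f x y| < e.
Proof.
move=> If e0; have x1 : x <= x + 1 by lra.
have /subspace_continuousP/(_ x) := itv_integral_continuous If x1.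
rewrite /= in_itv /= lexx x1 => /(_ isT); rewrite /from_subspace itv_integral1.
move=> /cvgr0_norm_lt/(_ _ e0); rewrite near_withinE => /nbhs_ballP[d /= d0 H].
exists (Num.min d 1); first by rewrite lt_min d0 ltr01.
move=> y /andP[xy yd]; have yd1 : y - x < Num.min d 1 by lra.
move: yd1; rewrite lt_min => /andP[yd1 yd2].
apply: H; last by rewrite /= in_itv /= xy; lra.
by rewrite /ball /= distrC ger0_norm ?subr_ge0.
Qed.

Lemma itv_integral_eq0 f x y : x <= y -> (forall t, x <= t <= y -> f t = 0) ->
  itv_integral f x y = 0.
Proof.
move=> xy f0; rewrite (eq_itv_integral (g := fun=> 0))//.
by rewrite itv_integral_cst// mul0r.
Qed.

(** The derivative of the step is an approximate Dirac mass: nonnegative, of integral one, and zero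
    outside [[a, a + d]]. *)
Lemma dsmooth_step_cvg U a e : continuous U -> 0 <= a -> 0 < e ->
  exists2 d0, 0 < d0 & forall d, 0 < d < d0 -> a + d <= 1 ->
  `|itv_integral (fun t => U t * dsmooth_step d (t - a)) 0 1 - U a| <= e.
Proof.
move=> cU a0 e0; have /cvgr_dist_le/(_ _ e0)/nbhs_ballP[d0 /= d00 H] := cU a.
exists d0 => // d /andP[dgt dlt] ad1.
have ci := @dsmooth_step_continuous R d a.
have iD := continuous_itv_integrable ci.
have iU : itv_integrable (fun t => U t * dsmooth_step d (t - a)).
  by apply: itv_integrableM => //; exact: continuous_itv_integrable.
have aad : a <= a + d by lra.
rewrite (itv_integral_split iU a0) ?(le_trans aad)//.
rewrite (itv_integral_split iU aad ad1).
rewrite [X in X + _ - _]itv_integral_eq0//; last first.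
  move=> t /andP[_ ta]; rewrite dsmooth_step_le0 ?mulr0//; lra.
rewrite [X in _ + (_ + X) - _]itv_integral_eq0//; last first.
  move=> t /andP[ta _]; rewrite dsmooth_step_ge ?mulr0//; lra.
rewrite add0r addr0.
have d1 : itv_integral (fun t => dsmooth_step d (t - a)) a (a + d) = 1.
  have dn0 : d != 0 by rewrite lt0r_neq0.
  have ds t := @is_derive_smooth_step R d a t dn0.
  rewrite (itv_integral_derive aad ds ci).
  have -> : a + d - a = d by ring.
  by rewrite subrr smooth_step_ge// smooth_step_le0// subr0.
have B t : a <= t <= a + d -> `|U a - U t| <= e.
  move=> /andP[at_ tad]; apply: H.
  by rewrite /ball /= distrC ger0_norm ?subr_ge0//; lra.
have lo :
    itv_integral (fun t => (U a - e) * dsmooth_step d (t - a)) a (a + d) <=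
    itv_integral (fun t => U t * dsmooth_step d (t - a)) a (a + d).
  apply: le_itv_integral => //; first exact: itv_integrableZ.
  move=> t /B; rewrite ler_norml => /andP[? ?].
  by rewrite ler_wpM2r ?dsmooth_step_ge0//; lra.
have hi : itv_integral (fun t => U t * dsmooth_step d (t - a)) a (a + d) <=
    itv_integral (fun t => (U a + e) * dsmooth_step d (t - a)) a (a + d).
  apply: le_itv_integral => //; first exact: itv_integrableZ.
  move=> t /B; rewrite ler_norml => /andP[? ?].
  by rewrite ler_wpM2r ?dsmooth_step_ge0//; lra.
rewrite itv_integralZ// d1 in lo; rewrite itv_integralZ// d1 in hi.
by rewrite ler_norml; apply/andP; split; lra.
Qed.

Lemma smooth_step_continuous d a : d != 0 ->
  continuous (fun t : R => smooth_step d (t - a)).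
Proof.
move=> d0 t; apply: differentiable_continuous; apply/derivable1_diffP.
exact: (@ex_derive _ _ _ _ _ _ _ (is_derive_smooth_step a t d0)).
Qed.

(** The step differs from the indicator of [[a, 1]] only on [[a, a + d]], where the integral of
    [|g|] is small. *)
Lemma smooth_step_cvg g a e : itv_integrable g -> 0 <= a -> 0 < e ->
  exists2 d0, 0 < d0 & forall d, 0 < d < d0 -> a + d <= 1 ->
  `|itv_integral (fun t => g t * smooth_step d (t - a)) 0 1 -
    itv_integral g a 1| <= e.
Proof.
move=> Ig a0 e0.
have [d0 d00 H] := itv_integral_small a (itv_integrable_norm Ig) e0.
exists d0 => // d /andP[dgt dlt] ad1.
have dn0 : d != 0 by rewrite lt0r_neq0.
have iS : itv_integrable (fun t => g t * smooth_step d (t - a)).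
  by apply: itv_integrableM => //; exact: smooth_step_continuous.
have aad : a <= a + d by lra.
rewrite (itv_integral_split iS a0) ?(le_trans aad)//.
rewrite (itv_integral_split iS aad ad1) (itv_integral_split Ig aad ad1).
rewrite [X in X + _ - _]itv_integral_eq0//; last first.
  move=> t /andP[_ ta]; rewrite smooth_step_le0 ?mulr0//; lra.
rewrite [X in _ + (_ + X) - _](@eq_itv_integral _ _ g); last first.
  move=> t /andP[ta _]; rewrite smooth_step_ge ?mulr1//; lra.
rewrite (_ : _ - _ =
  itv_integral (fun t => g t * smooth_step d (t - a)) a (a + d) +
  -1 * itv_integral g a (a + d)); last by ring.
rewrite -itv_integralZ//.
rewrite -itv_integralD//; last exact: itv_integrableZ.
apply: (le_trans (norm_itv_integral _ _ _)).
  by apply: itv_integrableD => //; exact: itv_integrableZ.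
apply: (@le_trans _ _ (itv_integral (fun t => `|g t|) a (a + d))).
  apply: le_itv_integral.
  - by apply/itv_integrable_norm/itv_integrableD => //; exact: itv_integrableZ.
  - exact: itv_integrable_norm.
  - move=> t _; rewrite mulN1r -[X in _ - X]mulr1 -mulrBr normrM ler_piMr//.
    have /andP[? ?] := smooth_step_itv (t - a) dgt.
    by rewrite ler_norml; apply/andP; split; lra.
have := H (a + d) ltac:(by rewrite aad ltrD2l).
by rewrite ltr_norml => /andP[_ /ltW].
Qed.

Lemma test_function_step_diff a b d : 0 < d -> 0 < a -> a < b -> b + d < 1 ->
  test_function (fun t : R => smooth_step d (t - a) - smooth_step d (t - b)) /\
  (forall t : R,
    derive1 (fun t => smooth_step d (t - a) - smooth_step d (t - b)) t =
    dsmooth_step d (t - a) - dsmooth_step d (t - b)).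
Proof.
move=> d0 a0 ab bd1; have dn0 : d != 0 by rewrite lt0r_neq0.
have D t := is_deriveB (is_derive_smooth_step a t dn0)
  (is_derive_smooth_step b t dn0).
have D1 t : derive1 (fun t => smooth_step d (t - a) - smooth_step d (t - b)) t =
    dsmooth_step d (t - a) - dsmooth_step d (t - b).
  by rewrite derive1E; exact: (@derive_val _ _ _ _ _ _ _ (D t)).
split=> //; split.
- by move=> t; exact: (@ex_derive _ _ _ _ _ _ _ (D t)).
- rewrite (_ : derive1 _ =
    fun t => dsmooth_step d (t - a) - dsmooth_step d (t - b)).
    by move=> t; apply: cvgB; exact: dsmooth_step_continuous.
  by apply/funext => t; exact: D1.
- apply: (@subset_trans _ `[a, b + d]).
    have /closure_id -> : closed (`[a, b + d] : set R) by exact: itv_closed.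
    apply: closure_subset => t /=; rewrite in_itv /=; apply: contraR.
    rewrite negb_and -!ltNge => /orP[ta|tb].
      by rewrite !smooth_step_le0 ?subrr//; lra.
    by rewrite !smooth_step_ge ?subrr//; lra.
  by move=> t /=; rewrite !in_itv /=; lra.
Qed.

(* Test with smoothed indicators of [[a, b]]. *)
Lemma weak_derivative_increment U g a b : continuous U -> itv_integrable g ->
  (forall phi, test_function phi ->
     itv_integral (fun t => U t * derive1 phi t) 0 1 =
     - itv_integral (fun t => g t * phi t) 0 1) ->
  0 < a -> a < b -> b < 1 -> U b - U a = itv_integral g a b.
Proof.
move=> cU Ig weak a0 ab b1.
have a1 : a <= 1 by lra. have b0 : 0 <= b by lra.
rewrite (_ : itv_integral g a b = itv_integral g a 1 - itv_integral g b 1);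
  last by rewrite (itv_integral_split Ig (ltW ab) (ltW b1)) addrK.
apply/eqP; rewrite -subr_eq0 -normr_le0; apply/ler_addgt0Pl => e e0.
have e4 : 0 < e / 4 by lra.
have [d1 d10 H1] := dsmooth_step_cvg cU (ltW a0) e4.
have [d2 d20 H2] := dsmooth_step_cvg cU b0 e4.
have [d3 d30 H3] := smooth_step_cvg Ig (ltW a0) e4.
have [d4 d40 H4] := smooth_step_cvg Ig b0 e4.
(* The entry [1 - b] keeps the support of the test function inside the open interval. *)
pose m := Num.min (Num.min d1 d2) (Num.min (Num.min d3 d4) (1 - b)).
have m0 : 0 < m by rewrite !lt_min d10 d20 d30 d40 subr_gt0.
pose d := m / 2; have d0 : 0 < d by rewrite /d; lra.
have : d < m by rewrite /d; lra.
rewrite !lt_min => /andP[/andP[dd1 dd2] /andP[/andP[dd3 dd4] db]].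
have dn0 : d != 0 by rewrite lt0r_neq0.
have [test D1] := test_function_step_diff d0 a0 ab ltac:(lra).
have := weak _ test.
have iU : itv_integrable U by exact: continuous_itv_integrable.
have iD x : itv_integrable (fun t => U t * dsmooth_step d (t - x)).
  by apply: itv_integrableM => //; exact: dsmooth_step_continuous.
have iS x : itv_integrable (fun t => g t * smooth_step d (t - x)).
  by apply: itv_integrableM => //; exact: smooth_step_continuous.
rewrite (@eq_itv_integral _ _ (fun t => U t * dsmooth_step d (t - a) +
  (-1) * (U t * dsmooth_step d (t - b)))); last by move=> t _; rewrite D1; ring.
rewrite [in RHS](@eq_itv_integral _ _ (fun t => g t * smooth_step d (t - a) +
  (-1) * (g t * smooth_step d (t - b)))); last by move=> t _; ring.
rewrite !itv_integralD ?itv_integralZ//; try exact: itv_integrableZ.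
have := H1 d ltac:(by rewrite d0) ltac:(lra).
have := H2 d ltac:(by rewrite d0) ltac:(lra).
have := H3 d ltac:(by rewrite d0) ltac:(lra).
have := H4 d ltac:(by rewrite d0) ltac:(lra).
rewrite !ler_norml; clear; do 6! move: (itv_integral _ _ _) => ?.
by move=> /andP[? ?] /andP[? ?] /andP[? ?] /andP[? ?] ?; apply/andP; split; lra.
Qed.

End WeakDerivatives.

(** * Extension to the line and almost everywhere differentiability *)

Section SobolevPrimitive.
Variable R : realType.
Implicit Types (u g : R -> R) (x y : R).
Local Notation mu := (@lebesgue_measure R).

(** The retraction onto [[0, 1]]: composition with it extends a function by constants, which removes
    one-sided limits. *)
Definition clamp01 x : R := Num.max 0 (Num.min x 1).

Lemma clamp01_itv x : 0 <= clamp01 x <= 1.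
Proof. by rewrite /clamp01 le_max lexx ge_max ler01 ge_min lexx orbT. Qed.

Lemma clamp01_id x : 0 <= x <= 1 -> clamp01 x = x.
Proof. by move=> /andP[x0 x1]; rewrite /clamp01 min_l// max_r. Qed.

Lemma clamp01_le0 x : x <= 0 -> clamp01 x = 0.
Proof. by move=> x0; rewrite /clamp01 min_l ?max_l// (le_trans x0). Qed.

Lemma clamp01_ge1 x : 1 <= x -> clamp01 x = 1.
Proof. by move=> x0; rewrite /clamp01 min_r ?max_r// (le_trans x0). Qed.

Lemma clamp01_continuous : continuous clamp01.
Proof.
move=> x; apply: (@continuous_max _ _ (fun=> 0) (fun y => Num.min y 1)).
  exact: cvg_cst.
apply: (@continuous_min _ _ (fun y => y) (fun=> 1)); first exact: cvg_id.
exact: cvg_cst.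
Qed.

Lemma clamp01_comp_continuous u : {within `[0, 1], continuous u} ->
  continuous (u \o clamp01).
Proof.
move=> /subspace_continuousP cu x.
have cx : `[0, 1]%classic (clamp01 x) by rewrite /= in_itv /= clamp01_itv.
have h : clamp01 @ x --> within `[0, 1] (nbhs (clamp01 x)).
  move=> A nA.
  have /nbhs_ballP[e /= e0 eA] :
    nbhs (clamp01 x) [set y | `[0, 1]%classic y -> A y] by exact: nA.
  have /cvgr_dist_lt/(_ _ e0) := @clamp01_continuous x.
  apply: filterS => y xy; apply: eA => //.
  by rewrite /= in_itv /=; exact: clamp01_itv.
exact: (cvg_comp _ _ h (cu _ cx)).
Qed.

Lemma itv_integral_oo f : itv_integrable f ->
  \int[mu]_(x in `]0, 1[) f x = itv_integral f 0 1.
Proof.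
move=> If; rewrite Rintegral_itv_bndo_bndc; last first.
  by apply: integrableS (If 0 1) => //; exact: subset_itv_oo_cc.
rewrite Rintegral_itv_obnd_cbnd//.
by apply: integrableS (If 0 1) => //; apply: subset_itvr; rewrite bnd_simp.
Qed.

Lemma H1_primitive u : {within `[0, 1], continuous u} -> H1_01 u ->
  exists g, [/\ measurable_fun setT g, itv_integrable (fun x => g x ^+ 2),
    (forall x y, x <= y -> u (clamp01 y) - u (clamp01 x) = itv_integral g x y) &
    {ae mu, forall x, 0 < x < 1 -> is_derive x 1 u (g x)}].
Proof.
move=> cu [_ [g0 [mg0 g0_L2] weak]].
pose U := u \o clamp01.
have cU : continuous U by exact: clamp01_comp_continuous.
(* Zero outside the open interval, to match the constant extension [U]. *)
pose g : R -> R := g0 \_ `]0, 1[.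
have gE x : 0 < x < 1 -> g x = g0 x.
  by move=> x01; rewrite /g patchE mem_set//= in_itv.
have g0E x : ~~ (0 < x < 1) -> g x = 0.
  by move=> x01; rewrite /g patchE memNset//= in_itv /=; exact/negP.
have mg : measurable_fun setT g by apply/(measurable_restrictT _ _).1.
have Ig2 : itv_integrable (fun x => g x ^+ 2).
  have : mu.-integrable `]0%R, 1%R[ (EFin \o (fun x => g0 x ^+ 2)).
    apply/integrableP; split.
      by apply/measurable_EFinP; exact: measurable_funX.
    apply: le_lt_trans g0_L2; rewrite le_eqVlt; apply/orP; left; apply/eqP.
    by apply: eq_integral => x _; rewrite /= ger0_norm ?sqr_ge0.
  move=> /integrable_mkcond; rewrite (_ : _ \_ _ = EFin \o (fun x => g x ^+ 2)).
    by move=> /(_ (measurable_itv _)) I2 x y; apply: integrableS I2.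
  apply/funext => x; rewrite /g /= !patchE; case: ifP => //=.
  by rewrite expr0n.
have Ig : itv_integrable g.
  apply: (itv_integrable_le mg (itv_integrableD Ig2 (itv_integrable_cst 1))).
  by move=> x; exact: le_sqrD1.
have inner x y : 0 < x -> x < y -> y < 1 -> U y - U x = itv_integral g x y.
  apply: weak_derivative_increment => // phi test.
  have [dphi cdphi _] := test.
  have cphi : continuous phi.
    by move=> z; apply: differentiable_continuous; apply/derivable1_diffP.
  rewrite -itv_integral_oo; last first.
    by apply: itv_integrableM => //; exact: continuous_itv_integrable.
  rewrite -itv_integral_oo; last by exact: itv_integrableM.
  have := weak _ test.
  rewrite (@eq_Rintegral _ _ _ mu _ (fun t => U t * derive1 phi t)); last first.
    move=> t; rewrite inE /= in_itv /= => /andP[t0 t1].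
    by rewrite /U /= clamp01_id// !ltW.
  move=> ->; congr (- _); apply: eq_Rintegral => t.
  by rewrite inE /= in_itv /= => t01; rewrite gE.
(* Interior increments make the difference of [U] and the primitive of [g] constant inside;
   continuity carries this to the endpoints. *)
have closed01 x y : 0 <= x -> x <= y -> y <= 1 ->
    U y - U x = itv_integral g x y.
  pose w z := U z - itv_integral g 0 z.
  have cw : {within `[0, 1], continuous w}.
    move=> /= z; apply: cvgB; first exact: continuous_subspaceT cU z.
    exact: itv_integral_continuous Ig ler01 z.
  have w_cst z : 0 < z < 1 -> w z = w (1 / 2).
    move=> /andP[z0 z1]; rewrite /w; have [zh|hz|->//] := ltgtP z (1 / 2).
      have := inner z (1 / 2) z0 zh ltac:(lra).
      by rewrite (itv_integral_split Ig (ltW z0) (ltW zh)); lra.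
    have h0 : 0 < 1 / 2 :> R by lra.
    have := inner (1 / 2) z h0 hz z1.
    by rewrite (itv_integral_split Ig (ltW h0) (ltW hz)); lra.
  have /(continuous_within_itvP _ ltr01)[_ w0 w1] := cw.
  have w0E : w 0 = w (1 / 2).
    suff h : w x @[x --> 0^'+] --> w (1 / 2) by exact: (cvg_unique _ w0 h).
    apply: cvg_near_cst; near=> z; apply: w_cst.
    by apply/andP; split; near: z; [exact: nbhs_right_gt|apply: nbhs_right_lt].
  have w1E : w 1 = w (1 / 2).
    suff h : w x @[x --> 1^'-] --> w (1 / 2) by exact: (cvg_unique _ w1 h).
    apply: cvg_near_cst; near=> z; apply: w_cst.
    by apply/andP; split; near: z; [apply: nbhs_left_gt|exact: nbhs_left_lt].
  have wE z : 0 <= z <= 1 -> w z = w (1 / 2).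
    move=> /andP[]; rewrite le_eqVlt => /predU1P[<-//|z0].
    by rewrite le_eqVlt => /predU1P[->//|z1]; apply: w_cst; rewrite z0.
  move=> x0 xy y1; have := wE x ltac:(lra); have := wE y ltac:(lra).
  rewrite /w (itv_integral_split Ig x0 xy); lra.
have incr x y : x <= y -> U y - U x = itv_integral g x y.
  have step x' y' z : x' <= y' -> y' <= z ->
      U y' - U x' = itv_integral g x' y' ->
      U z - U y' = itv_integral g y' z -> U z - U x' = itv_integral g x' z.
    by move=> h1 h2 e1 e2; rewrite (itv_integral_split Ig h1 h2) -e1 -e2; lra.
  have neg x' y' : x' <= y' -> y' <= 0 -> U y' - U x' = itv_integral g x' y'.
    move=> xy' y0; rewrite itv_integral_eq0 /U /=.
    - by rewrite !clamp01_le0 ?subrr// (le_trans xy').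
    - by [].
    - move=> t /andP[_ ty]; apply: g0E; rewrite negb_and -leNgt.
      by rewrite (le_trans ty).
  have pos x' y' : x' <= y' -> 1 <= x' -> U y' - U x' = itv_integral g x' y'.
    move=> xy' x1; rewrite itv_integral_eq0 /U /=.
    - by rewrite !clamp01_ge1 ?subrr// (le_trans _ xy').
    - by [].
    - move=> t /andP[xt _]; apply: g0E; rewrite negb_and -!leNgt.
      by rewrite (le_trans x1)// orbT.
  have nonneg x' y' : 0 <= x' -> x' <= y' -> U y' - U x' = itv_integral g x' y'.
    move=> x0 xy'; have [x1|/ltW x1] := leP 1 x'; first exact: pos.
    have [y1|/ltW y1] := leP y' 1; first exact: closed01.
    by apply: (step _ 1) => //; [exact: closed01|exact: pos].
  move=> xy; have [x0|/ltW x0] := leP 0 x; first exact: nonneg.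
  have [y0|/ltW y0] := leP y 0; first exact: neg.
  by apply: (step _ 0) => //; [exact: neg|exact: nonneg].
exists g; split => //.
have If z : mu.-integrable [set` Interval (BLeft (-1)) (BRight z)] (EFin \o g).
  exact: Ig.
have IT : mu.-integrable setT (EFin \o g).
  move: (Ig 0 1) => /integrable_mkcond.
  rewrite (_ : _ \_ _ = EFin \o g); first exact.
  apply/funext => x; rewrite patchE /=; case: ifPn => //; rewrite notin_setE /=.
  rewrite in_itv /= => /negP x01; rewrite g0E//; apply: contra x01.
  by move=> /andP[x0 x1]; rewrite !ltW.
(* Lebesgue's differentiation theorem; the base point [-1] is an arbitrary point left of the
   interval, and [U (-1)] the constant of integration. *)
have := FTC1 If (open_integrable_locally openT IT).
apply: filterS; first exact: (ae_filter_ringOfSetsType mu).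
move=> x H /andP[x0 x1].
have [|dF dFx] := H; first by rewrite lte_fin; lra.
have {}dF :
    is_derive x 1 (fun y => \int[mu]_(t in `[-1, y]) g t + U (-1)) (g x).
  have D1 := DeriveDef dF (esym (etrans (esym dFx) (derive1E _ _))).
  by apply: is_derive_eq; rewrite addr0.
apply: near_eq_is_derive dF; near=> y.
have y0 : 0 < y by near: y; exact: lt_nbhsr.
have y1 : y < 1 by near: y; exact: lt_nbhsl.
have y01 : 0 <= y <= 1 by rewrite !ltW.
have := incr (-1) y ltac:(lra); rewrite /itv_integral => <-.
by rewrite /U /= (clamp01_id y01) subrK.
Unshelve. all: by end_near. Qed.

End SobolevPrimitive.

Section OneSidedDerivatives.
Variable R : realType.
Implicit Types (f g : R -> R) (x y d : R).

Lemma is_derive_deriv01 f x : derivable01 f x -> 0 < x < 1 ->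
  is_derive x 1 f (deriv01 f x).
Proof.
move=> df /andP[x0 x1].
apply/is_derive1_caratheodory.
exists (fun z => if z == x then deriv01 f x else quotient01 f x z); split.
- move=> z; case: eqVneq => [->|zx]; first by rewrite !subrr mulr0.
  by rewrite /quotient01 divfK// subr_eq0.
- apply/cvgrPdist_lt => e e0.
  have /cvgr_dist_lt/(_ _ e0) H :
      quotient01 f x @ within `[0, 1] x^' --> deriv01 f x.
    exact: df.
  have {}H : \forall z \near x, z != x -> 0 <= z <= 1 ->
      `|deriv01 f x - quotient01 f x z| < e.
    move: H; rewrite near_withinE => H.
    have : \forall z \near x, z != x -> `[0, 1]%classic z ->
        `|deriv01 f x - quotient01 f x z| < e by exact: H.
    by apply: filterS => z Hz zx z01; apply: Hz => //=; rewrite in_itv.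
  rewrite eqxx; near=> z; case: eqVneq => [_|zx]; first by rewrite subrr normr0.
  have z0 : 0 < z by near: z; exact: lt_nbhsr.
  have z1 : z < 1 by near: z; exact: lt_nbhsl.
  move: zx (conj z0 z1); near: z; apply: filterS H => z Hz zx [z0 z1].
  by apply: Hz => //; rewrite !ltW.
- by rewrite eqxx.
Unshelve. all: by end_near. Qed.

Lemma is_derive_quotient01 f g x d : 0 <= x <= 1 ->
  (forall y, 0 <= y <= 1 -> f y = g y) -> is_derive x 1 g d ->
  quotient01 f x @ within `[0, 1] x^' --> d.
Proof.
move=> x01 fg /is_derive1_caratheodory[h [hE hc <-]].
have : h @ within `[0, 1] x^' --> h x.
  apply: cvg_within_filter; apply: cvg_trans hc; apply: cvg_app.
  exact: nbhs_dnbhs.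
apply: cvg_trans; apply: near_eq_cvg; rewrite near_withinE; near=> y => /=.
rewrite in_itv /= => y01; rewrite /quotient01 !fg// hE mulfK// subr_eq0.
by near: y; exact: nbhs_dnbhs_neq.
Unshelve. all: by end_near. Qed.

(** One-sided derivatives are computed through a function on the line that is differentiable at the
    point and agrees on [[0, 1]]. *)
Lemma deriv01_eq f g x d : 0 <= x <= 1 ->
  (forall y, 0 <= y <= 1 -> f y = g y) -> is_derive x 1 g d ->
  derivable01 f x /\ deriv01 f x = d.
Proof.
move=> x01 fg dg; have H := is_derive_quotient01 x01 fg dg.
have F : ProperFilter (within `[0, 1] x^').
  by apply: within01_proper; rewrite in_itv.
split; first by apply/cvg_ex; exists d.
exact/cvg_lim.
Qed.

Lemma C1_01_increment f x y : C1_01 f -> 0 <= x -> x <= y -> y <= 1 ->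
  f y - f x = itv_integral (deriv01 f \o @clamp01 R) x y.
Proof.
move=> [df cdf] x0; rewrite le_eqVlt => /predU1P[->|xy] y1.
  by rewrite itv_integral1 subrr.
have cf : {within `[0, 1], continuous f}.
  apply/subspace_continuousP => z z01; have z01' : z \in `[0, 1] by [].
  have H := derivable01_cvg z01' (df _ z01').
  apply/cvgrPdist_lt => e e0; move/cvgr_dist_lt : H => /(_ _ e0).
  rewrite !near_withinE => H.
  have : \forall t \near z, t != z -> `[0, 1]%classic t -> `|f z - f t| < e.
    exact: H.
  apply: filterS => t Ht t01; case: (eqVneq t z) => [->|tz]; last exact: Ht.
  by rewrite subrr normr0.
have {}cf : {within `[x, y], continuous f}.
  by apply: continuous_subspaceW cf; apply: subset_itv; rewrite bnd_simp.
have /(continuous_within_itvP _ xy)[_ fx fy] := cf.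
have cu := clamp01_comp_continuous cdf.
have D t : t \in `]x, y[ -> is_derive t 1 f (deriv01 f (clamp01 t)).
  rewrite in_itv /= => /andP[xt ty].
  have t0 : 0 < t by lra.
  have t1 : t < 1 by lra.
  rewrite clamp01_id; last by rewrite !ltW.
  apply: is_derive_deriv01; last by rewrite t0.
  by apply: df; rewrite in_itv /= !ltW.
rewrite /itv_integral /Rintegral (@continuous_FTC2 _ _ f x y xy).
- by [].
- exact: continuous_subspaceT cu.
- split=> // t txy; exact: (@ex_derive _ _ _ _ _ _ _ (D t txy)).
- move=> t txy; rewrite derive1E; exact: (@derive_val _ _ _ _ _ _ _ (D t txy)).
Qed.

End OneSidedDerivatives.

(** * Passage from parametrized curves to velocity fields *)

Section CurveVelocity.
Variable R : realType.
Local Notation mu := (@lebesgue_measure R).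
Implicit Types (x y : R) (gamma : R -> R * R).

(* The library version asks for the measurability of [f2], which is not known
   for the pointwise curvature. *)
Lemma ge0_le_integral_sup (D : set R) (f1 f2 : R -> \bar R) :
  (forall x, D x -> (0 <= f1 x)%E) -> (forall x, D x -> (f1 x <= f2 x)%E) ->
  (\int[mu]_(x in D) f1 x <= \int[mu]_(x in D) f2 x)%E.
Proof.
move=> f10 f12; rewrite integral_mkcond [leRHS]integral_mkcond.
have h10 x : (0 <= (f1 \_ D) x)%E by apply: erestrict_ge0.
have h12 x : ((f1 \_ D) x <= (f2 \_ D) x)%E by apply: lee_restrict.
rewrite !ge0_integralTE//; last by move=> x; exact: le_trans (h12 x).
apply: ub_ereal_sup => _ [h hf <-]; apply: ereal_sup_ubound; exists h => // x.
exact: le_trans (hf x) (h12 x).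
Qed.

(** The coefficient [w] of the part along the velocity may stay unspecified: the curvature only sees
    the normal component. *)
Lemma is_derive_vtan (c : velocity R) x (a1 a2 : R) :
  is_derive x 1 (fun y => (vel c y).1) a1 ->
  is_derive x 1 (fun y => (vel c y).2) a2 ->
  exists w, is_derive x 1 (fun y => (vtan c y).1)
      (a1 / vspeed c x + (vel c x).1 * w) /\
    is_derive x 1 (fun y => (vtan c y).2)
      (a2 / vspeed c x + (vel c x).2 * w).
Proof.
move=> d1 d2; have v0 := vspeed_gt0 c x.
have q0 : 0 < (vel c x).1 ^+ 2 + (vel c x).2 ^+ 2.
  by rewrite -vspeed_sqr exprn_gt0.
have dq : is_derive x 1 (fun y => (vel c y).1 ^+ 2 + (vel c y).2 ^+ 2)
    (2 * (vel c x).1 * a1 + 2 * (vel c x).2 * a2).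
  have := is_deriveD (is_deriveM d1 d1) (is_deriveM d2 d2) => H.
  by apply: (is_derive_eq H); rewrite /GRing.scale /=; ring.
have ds := @is_derive1_comp _ Num.sqrt
  (fun y => (vel c y).1 ^+ 2 + (vel c y).2 ^+ 2) x _ _ (is_derive1_sqrt q0) dq.
have [s ds'] : exists s, is_derive x 1 (vspeed c) s by eexists; exact: ds.
have dw := @is_deriveV _ (vspeed c) x s 1 (lt0r_neq0 v0) ds'.
exists (- vspeed c x ^- 2 * s); split.
- have H := is_deriveM d1 dw; apply: (is_derive_eq H).
  by rewrite /GRing.scale /=; ring.
- have H := is_deriveM d2 dw; apply: (is_derive_eq H).
  by rewrite /GRing.scale /=; ring.
Qed.

Lemma curvature_vcurv gamma (c : velocity R) x : 0 <= x <= 1 ->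
  (forall y, 0 <= y <= 1 -> vel c y = partial_x gamma y) ->
  is_derive x 1 (fun y => (vel c y).1) (acc c x).1 ->
  is_derive x 1 (fun y => (vel c y).2) (acc c x).2 ->
  curvature gamma x = vcurv c x.
Proof.
move=> x01 velE d1 d2; have [w [t1 t2]] := is_derive_vtan d1 d2.
have tE y : 0 <= y <= 1 -> tangent gamma y = vtan c y.
  move=> y01; rewrite /tangent /partial_s /vtan /vspeed (velE y y01).
  by rewrite /speed.
have [_ D1] := deriv01_eq x01 (fun y y01 => congr1 fst (tE y y01)) t1.
have [_ D2] := deriv01_eq x01 (fun y y01 => congr1 snd (tE y y01)) t2.
rewrite /curvature /partial_s /normal tE// /partial_x D1 D2 /dot2 /=.
have -> : speed gamma x = vspeed c x by rewrite /vspeed velE.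
rewrite /vcurv; have v0 := lt0r_neq0 (vspeed_gt0 c x); field.
by rewrite v0.
Qed.

Lemma speed_vspeed gamma (c : velocity R) x :
  vel c x = partial_x gamma x -> speed gamma x = vspeed c x.
Proof. by rewrite /speed /vspeed => ->. Qed.

(** An inequality between the energies is enough, since curves of the minimizer are only bounded
    from below; it avoids any claim on the exceptional set where the velocity has no derivative. *)
Lemma curve_velocity gamma : regular gamma -> class_H2 gamma ->
  exists c : velocity R,
    [/\ forall x, 0 <= x <= 1 -> tangent gamma x = vtan c x,
        forall q x y, 0 <= x -> x <= y -> y <= 1 ->
          dot2 q (gamma y) - dot2 q (gamma x) = vchord c q x y &
        ((venergy c 0 1)%:E <= curve_energy gamma)%E].
Proof.
move=> [C1 C2 s0] [[_ H1] [_ H2]].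
have [g1 [mg1 sg1 inc1 ae1]] := H1_primitive C1.2 H1.
have [g2 [mg2 sg2 inc2 ae2]] := H1_primitive C2.2 H2.
pose v x := partial_x gamma (clamp01 x).
have v0 x : norm2 (v x) != 0.
  by apply: s0; rewrite in_itv /= clamp01_itv.
pose c := @Velocity R v (fun x => (g1 x, g2 x))
  (clamp01_comp_continuous C1.2) (clamp01_comp_continuous C2.2) v0 mg1 mg2
  sg1 sg2 inc1 inc2.
have velE y : 0 <= y <= 1 -> vel c y = partial_x gamma y.
  by move=> y01; rewrite /= /v clamp01_id.
exists c; split.
- move=> y y01; rewrite /tangent /partial_s /vtan /vspeed (velE y y01).
  by rewrite /speed.
- move=> q x y x0 xy y1.
  have -> : dot2 q (gamma y) - dot2 q (gamma x) =
      q.1 * ((gamma y).1 - (gamma x).1) + q.2 * ((gamma y).2 - (gamma x).2).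
    by rewrite /dot2; ring.
  rewrite (C1_01_increment C1 x0 xy y1) (C1_01_increment C2 x0 xy y1).
  have i1 := continuous_itv_integrable (@vel1_continuous _ c).
  have i2 := continuous_itv_integrable (@vel2_continuous _ c).
  rewrite -!itv_integralZ// -itv_integralD; try exact: itv_integrableZ.
  apply: eq_itv_integral => t _; rewrite /dot2 /vtan /=.
  have := lt0r_neq0 (vspeed_gt0 c t) => vt.
  by rewrite !mulrA -mulrDl divfK.
- have [N1 [mN1 N10 N1P]] := ae1; have [N2 [mN2 N20 N2P]] := ae2.
  (* The endpoints join the exceptional sets because differentiability is known in the open interval
     only. *)
  pose N := N1 `|` N2 `|` ([set 0] `|` [set 1]).
  have mN : measurable N by do 2! apply: measurableU => //; exact: measurableU.
  have N0 : mu N = 0%E.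
    have n1 x : mu.-negligible [set x].
      by apply/negligibleP => //; exact: lebesgue_measure_set1.
    apply/negligibleP => //; apply: negligibleU; last exact: negligibleU.
    by apply: negligibleU; apply/negligibleP.
  have kE x : 0 <= x <= 1 -> ~ N x -> curvature gamma x = vcurv c x.
    move=> x01 Nx.
    have x0 : 0 < x.
      have /andP[x0 _] := x01; rewrite lt_neqAle x0 andbT eq_sym.
      by apply/eqP => xE; apply: Nx; right; left.
    have x1 : x < 1.
      have /andP[_ x1] := x01; rewrite lt_neqAle x1 andbT.
      by apply/eqP => xE; apply: Nx; right; right.
    have nx : \forall y \near x, clamp01 y = y.
      near=> y; apply: clamp01_id; apply/andP; split; apply/ltW; near: y.
        exact: lt_nbhsr.
      exact: lt_nbhsl.
    apply: curvature_vcurv => //.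
    + apply: (@near_eq_is_derive _ _ _ (deriv01 (fun y => (gamma y).1))).
        by apply: filterS nx => y yE; rewrite /= yE.
      have : ~ N1 x by move=> N1x; apply: Nx; left; left.
      by move=> /(contra_notP (@N1P x)) /=; apply; rewrite x0.
    + apply: (@near_eq_is_derive _ _ _ (deriv01 (fun y => (gamma y).2))).
        by apply: filterS nx => y yE; rewrite /= yE.
      have : ~ N2 x by move=> N2x; apply: Nx; left; right.
      by move=> /(contra_notP (@N2P x)) /=; apply; rewrite x0.
  pose dens t := (vcurv c t ^+ 2 + 1 ^+ 2) * vspeed c t.
  have Id : itv_integrable dens by exact: energy_density_integrable.
  have -> : venergy c 0 1 = itv_integral dens 0 1.
    by rewrite energy_densityE expr1n mul1r.
  have dens0 t : 0 <= dens t.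
    by rewrite mulr_ge0 ?addr_ge0 ?sqr_ge0// ltW// vspeed_gt0.
  have -> : (itv_integral dens 0 1)%:E =
      (\int[mu]_(t in `[0%R, 1%R]) (dens t)%:E)%E.
    rewrite /itv_integral /Rintegral fineK//.
    exact: integrable_fin_num (Id 0 1).
  have mdens : measurable_fun (`[0%R, 1%R] : set R) (EFin \o dens).
    exact: measurable_int (Id 0 1).
  have dens0E t : `[0%R, 1%R]%classic t -> (0 <= (EFin \o dens) t)%E.
    by move=> _; rewrite lee_fin.
  have mD : measurable (`[0%R, 1%R] : set R) by exact: measurable_itv.
  (* The null set is removed on the side of the measurable density; off it the two integrands agree,
     and on it the energy density is nonnegative. *)
  have /= -> := ge0_negligible_integral mN mD mdens dens0E N0.
  rewrite /curve_energy setDE integral_mkcondr.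
  apply: ge0_le_integral_sup => x /=; rewrite in_itv /= patchE.
    by move=> _; case: ifPn => // _; rewrite lee_fin.
  move=> x01; case: ifPn; last first.
    by move=> _; rewrite lee_fin mulr_ge0 ?addr_ge0 ?sqr_ge0 ?sqrtr_ge0.
  rewrite inE /= => Nx; rewrite lee_fin (kE _ x01 Nx) /dens expr1n.
  by rewrite (speed_vspeed (velE _ x01)).
Unshelve. all: by end_near. Qed.

End CurveVelocity.

(** * The standard double bubble as a competitor *)

Section DoubleBubble.
Variable R : realType.
Local Notation mu := (@lebesgue_measure R).
Implicit Types (f g : R -> R) (x y s : R).

Lemma is_derive_continuous f f' :
  (forall x, is_derive x 1 f (f' x)) -> continuous f.
Proof.
move=> df x; apply: differentiable_continuous; apply/derivable1_diffP.
exact: (@ex_derive _ _ _ _ _ _ _ (df x)).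
Qed.

Lemma itv01E x : (x \in `[0, 1]) = (0 <= x <= 1).
Proof. by rewrite in_itv. Qed.

Lemma continuous_L2_01 f g : continuous g ->
  (forall x, 0 <= x <= 1 -> f x = g x) -> L2_01 f.
Proof.
move=> cg fg; have oc x : x \in `]0, 1[ -> 0 <= x <= 1.
  by rewrite in_itv /= => /andP[? ?]; rewrite !ltW.
split.
  apply: (@eq_measurable_fun _ _ _ _ _ g).
    by move=> x; rewrite inE /= => /oc x01; rewrite fg.
  exact: measurable_funTS (continuous_measurable_fun cg).
have cg2 : continuous (fun x => g x ^+ 2).
  by move=> x; rewrite /GRing.exp /=; apply: cvgM; exact: cg.
have Ig : mu.-integrable (`]0%R, 1%R[ : set R) (EFin \o (fun x => g x ^+ 2)).
  have I01 := continuous_itv_integrable cg2.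
  by apply: integrableS (I01 0 1) => //; exact: subset_itv_oo_cc.
move/integrableP : Ig => [_]; apply: le_lt_trans.
rewrite le_eqVlt; apply/orP; left; apply/eqP; apply: eq_integral => x.
by rewrite inE /= => /oc x01; rewrite fg// ger0_norm// sqr_ge0.
Qed.

Lemma test_function_bounds (phi : R -> R) : test_function phi ->
  phi 0 = 0 /\ phi 1 = 0.
Proof.
move=> [_ _ supp]; split; apply/eqP/negPn/negP => phi0.
- have : `]0, 1[%classic (0 : R) by apply: supp; exact: subset_closure.
  by rewrite /= in_itv /= ltxx.
- have : `]0, 1[%classic (1 : R) by apply: supp; exact: subset_closure.
  by rewrite /= in_itv /= ltxx andbF.
Qed.

(** The weak derivative comes from integration by parts, without boundary terms since test functions
    vanish at [0] and [1]. *)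
Lemma H2_01_smooth f f' f'' : (forall x, is_derive x 1 f (f' x)) ->
  (forall x, is_derive x 1 f' (f'' x)) -> continuous f'' ->
  H2_01 f /\ (forall x, 0 <= x <= 1 -> deriv01 f x = f' x).
Proof.
move=> df df' cf''; have cf' := is_derive_continuous df'.
have D x : 0 <= x <= 1 -> derivable01 f x /\ deriv01 f x = f' x.
  by move=> x01; exact: deriv01_eq (df x).
have DE x : 0 <= x <= 1 -> deriv01 f x = f' x by move=> /D[].
split=> //; split.
  split; first by move=> x; rewrite itv01E => /D[].
  apply: (@subspace_eq_continuous _ _ _ f').
    by move=> x; rewrite inE /= in_itv /= => x01; rewrite /from_subspace DE.
  exact: continuous_subspaceT.
split; first exact: continuous_L2_01 cf' DE.
exists f''; first exact: continuous_L2_01 cf'' _.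
move=> phi test; have [phi0 phi1] := test_function_bounds test.
have [dphi cdphi _] := test.
have dp x : is_derive x 1 phi (derive1 phi x).
  by rewrite derive1E; exact: DeriveDef.
have cphi := is_derive_continuous dp.
have c1 : continuous (fun x => f' x * derive1 phi x).
  by move=> x; apply: cvgM; [exact: cf'|exact: cdphi].
have c2 : continuous (fun x => f'' x * phi x).
  by move=> x; apply: cvgM; [exact: cf''|exact: cphi].
rewrite (@eq_Rintegral _ _ _ mu _ (fun t => f' t * derive1 phi t)); last first.
  by move=> t; rewrite inE /= in_itv /= => /andP[? ?]; rewrite DE// !ltW.
rewrite !itv_integral_oo; try exact: continuous_itv_integrable.
apply/eqP; rewrite -addr_eq0.
rewrite -itv_integralD; try exact: continuous_itv_integrable.
have dM (t : R) : is_derive t 1 (fun x : R => f' x * phi x)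
    (f' t * derive1 phi t + f'' t * phi t).
  have H := is_deriveM (df' t) (dp t); apply: (is_derive_eq H).
  by rewrite /GRing.scale /=; ring.
rewrite (itv_integral_derive ler01 dM); first by rewrite phi0 phi1 !mulr0 subrr.
by move=> t; apply: cvgD; [exact: c1|exact: c2].
Qed.

Lemma curve_energy_cst (gamma : R -> R * R) (e : R) :
  (forall x, 0 <= x <= 1 -> (curvature gamma x ^+ 2 + 1) * speed gamma x = e) ->
  curve_energy gamma = e%:E.
Proof.
move=> He; rewrite /curve_energy (eq_integral (fun=> e%:E)); last first.
  by move=> x; rewrite inE /= in_itv /= => x01; rewrite He.
rewrite integral_cst//=.
have -> : mu `[0%R, 1%R] = 1%E.
  by rewrite (@lebesgue_measure_itv R `[0, 1]) /= lte_fin ltr01 sube0.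
by rewrite mule1.
Qed.

(** The direction of the tangent of the upper arc, from 120 to -120 degrees, so that both junctions
    with the horizontal segment have the right angles. *)
Definition bubble_angle x : R := 2 * (pi / 3) - 4 * (pi / 3) * x.

(** A circular arc of radius 9 / 10 starting at the origin; [s] is [1] for the upper arc and [-1]
    for its mirror image. *)
Definition bubble_arc s x : R * R :=
  (9 / 10 * (sin (2 * (pi / 3)) - sin (bubble_angle x)),
   s * (9 / 10 * (cos (bubble_angle x) - cos (2 * (pi / 3))))).

Definition bubble_segment x : R * R := (9 / 10 * Num.sqrt 3 * x, 0).

Definition bubble (i : 'I_3) : R -> R * R :=
  nth bubble_segment [:: bubble_arc 1; bubble_arc (-1)] i.

Lemma is_derive_cos_bubble x :
  is_derive x 1 (cos \o bubble_angle) (4 * (pi / 3) * sin (bubble_angle x)).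
Proof.
have d : is_derive x 1 bubble_angle (- (4 * (pi / 3))).
  by apply: is_derive_eq; rewrite /GRing.scale /=; ring.
have H := is_derive1_comp (is_derive_cos (bubble_angle x)) d.
by apply: (is_derive_eq H); ring.
Qed.

Lemma is_derive_sin_bubble x :
  is_derive x 1 (sin \o bubble_angle) (- (4 * (pi / 3)) * cos (bubble_angle x)).
Proof.
have d : is_derive x 1 bubble_angle (- (4 * (pi / 3))).
  by apply: is_derive_eq; rewrite /GRing.scale /=; ring.
have H := is_derive1_comp (is_derive_sin (bubble_angle x)) d.
by apply: (is_derive_eq H); ring.
Qed.

Section Arc.
Variable s : R.
Hypothesis s1 : s ^+ 2 = 1.

Let v : R := 9 / 10 * (4 * (pi / 3)).
Let th := bubble_angle.

Lemma bubble_arc_smooth :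
  [/\ class_H2 (bubble_arc s), regular (bubble_arc s) &
    forall x, 0 <= x <= 1 -> speed (bubble_arc s) x = v /\
      tangent (bubble_arc s) x = (cos (th x), s * sin (th x))].
Proof.
have v0 : 0 < v by rewrite /v; have := pi_gt0 R; lra.
have dc := is_derive_cos_bubble; have ds := is_derive_sin_bubble.
have cc := is_derive_continuous dc; have cs := is_derive_continuous ds.
have [H1 D1] : H2_01 (fun x => (bubble_arc s x).1) /\
    forall x, 0 <= x <= 1 ->
      deriv01 (fun x => (bubble_arc s x).1) x = v * cos (th x).
  apply: (@H2_01_smooth (fun x => (bubble_arc s x).1) (fun x => v * cos (th x))
    (fun x => v * (4 * (pi / 3)) * sin (th x))).
  - move=> x; have H := is_deriveZ (9 / 10) (is_deriveB
      (is_derive_cst (sin (2 * (pi / 3))) x 1) (ds x)).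
    by apply: (is_derive_eq H); rewrite /v /th /GRing.scale /=; ring.
  - move=> x; have H := is_deriveZ v (dc x).
    by apply: (is_derive_eq H); rewrite /th /GRing.scale /=; ring.
  - by move=> x; apply: cvgM; [exact: cvg_cst|exact: cs].
have [H2 D2] : H2_01 (fun x => (bubble_arc s x).2) /\
    forall x, 0 <= x <= 1 ->
      deriv01 (fun x => (bubble_arc s x).2) x = s * (v * sin (th x)).
  apply: (@H2_01_smooth (fun x => (bubble_arc s x).2)
    (fun x => s * (v * sin (th x)))
    (fun x => - (s * v * (4 * (pi / 3))) * cos (th x))).
  - move=> x; have H := is_deriveZ s (is_deriveZ (9 / 10) (is_deriveB (dc x)
      (is_derive_cst (cos (2 * (pi / 3))) x 1))).
    by apply: (is_derive_eq H); rewrite /v /th /GRing.scale /=; ring.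
  - move=> x; have H := is_deriveZ s (is_deriveZ v (ds x)).
    by apply: (is_derive_eq H); rewrite /th /GRing.scale /=; ring.
  - by move=> x; apply: cvgM; [exact: cvg_cst|exact: cc].
have sv x : 0 <= x <= 1 -> speed (bubble_arc s) x = v.
  move=> x01; rewrite /speed /partial_x (D1 _ x01) (D2 _ x01) /norm2 /=.
  rewrite (_ : _ + _ = v ^+ 2 * (cos (th x) ^+ 2 + s ^+ 2 * sin (th x) ^+ 2));
    last by ring.
  by rewrite s1 mul1r cos2Dsin2 mulr1 sqrtr_sqr gtr0_norm.
split=> //.
- split; [exact: H1.1|exact: H2.1|].
  by move=> x; rewrite itv01E => /sv ->; rewrite lt0r_neq0.
- move=> x x01; split; first exact: sv.
  rewrite /tangent /partial_s sv// /partial_x (D1 _ x01) (D2 _ x01) /=.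
  by congr pair; field; rewrite lt0r_neq0.
Qed.

Lemma bubble_arc_energy :
  curve_energy (bubble_arc s) = (4 * (pi / 3) * (10 / 9 + 9 / 10))%:E.
Proof.
have [_ _ st] := bubble_arc_smooth.
apply: curve_energy_cst => x x01; have [sx tx] := st _ x01.
have dc := is_derive_cos_bubble x.
have ds := is_deriveZ s (is_derive_sin_bubble x).
have [_ D1] := deriv01_eq x01 (fun y y01 => congr1 fst (st y y01).2) dc.
have [_ D2] := deriv01_eq x01 (fun y y01 => congr1 snd (st y y01).2) ds.
rewrite /curvature /partial_s /normal /partial_x D1 D2 tx sx /dot2 /=.
have p0 : pi / 3 != 0 :> R by rewrite lt0r_neq0// divr_gt0// pi_gt0.
have -> : 4 * (pi / 3) * sin (bubble_angle x) / v * - (s * sin (th x)) +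
    s *: (- (4 * (pi / 3)) * cos (bubble_angle x)) / v * cos (th x) =
    - (10 / 9) * s * (cos (th x) ^+ 2 + sin (th x) ^+ 2).
  by rewrite /GRing.scale /= /v /th; move: (pi / 3) p0 => P P0; field.
by rewrite cos2Dsin2 mulr1 exprMn s1 /v; field.
Qed.

End Arc.

Lemma bubble_segment_smooth :
  [/\ class_H2 bubble_segment, regular bubble_segment &
    forall x, 0 <= x <= 1 -> speed bubble_segment x = 9 / 10 * Num.sqrt 3 /\
      tangent bubble_segment x = (1, 0)].
Proof.
have v0 : 0 < 9 / 10 * Num.sqrt 3 :> R by rewrite mulr_gt0// ?sqrtr_gt0//; lra.
have [H1 D1] : H2_01 (fun x => (bubble_segment x).1) /\
    forall x, 0 <= x <= 1 ->
      deriv01 (fun x => (bubble_segment x).1) x = 9 / 10 * Num.sqrt 3.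
  apply: (@H2_01_smooth (fun x => (bubble_segment x).1)
    (fun=> 9 / 10 * Num.sqrt 3) (fun=> 0)).
  - by move=> x; apply: is_derive_eq; rewrite /GRing.scale /=; ring.
  - exact: cst_continuous.
have [H2 D2] : H2_01 (fun x => (bubble_segment x).2) /\
    forall x, 0 <= x <= 1 -> deriv01 (fun x => (bubble_segment x).2) x = 0.
  apply: (@H2_01_smooth (fun x => (bubble_segment x).2) (fun=> 0) (fun=> 0)).
  - by move=> x; exact: (is_derive_cst (0 : R) x 1).
  - exact: cst_continuous.
have sv x : 0 <= x <= 1 -> speed bubble_segment x = 9 / 10 * Num.sqrt 3.
  move=> x01; rewrite /speed /partial_x (D1 _ x01) (D2 _ x01) /norm2 /=.
  by rewrite expr0n addr0 sqrtr_sqr gtr0_norm.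
split=> //.
- split; [exact: H1.1|exact: H2.1|].
  by move=> x; rewrite itv01E => /sv ->; rewrite lt0r_neq0.
- move=> x x01; split; first exact: sv.
  rewrite /tangent /partial_s sv// /partial_x (D1 _ x01) (D2 _ x01) /=.
  by rewrite mul0r divff// lt0r_neq0.
Qed.

Lemma bubble_segment_energy :
  curve_energy bubble_segment = (9 / 10 * Num.sqrt 3)%:E.
Proof.
have [_ _ st] := bubble_segment_smooth.
apply: curve_energy_cst => x x01; have [sx tx] := st _ x01.
have [_ D1] := deriv01_eq x01 (fun y y01 => congr1 fst (st y y01).2)
  (is_derive_cst (1 : R) x 1).
have [_ D2] := deriv01_eq x01 (fun y y01 => congr1 snd (st y y01).2)
  (is_derive_cst (0 : R) x 1).
rewrite /curvature /partial_s /normal /partial_x D1 D2 tx sx /dot2 /=.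
by rewrite !mul0r addr0 expr0n add0r mul1r.
Qed.

Lemma theta_bubble : theta_network bubble.
Proof.
have s1 : (1 : R) ^+ 2 = 1 by rewrite expr1n.
have s2 : (- 1 : R) ^+ 2 = 1 by rewrite sqrrN expr1n.
have [H1 R1 T1] := bubble_arc_smooth s1.
have [H2 R2 T2] := bubble_arc_smooth s2.
have [H3 R3 T3] := bubble_segment_smooth.
have I0 : 0 <= (0 : R) <= 1 by rewrite lexx ler01.
have I1 : 0 <= (1 : R) <= 1 by rewrite lexx ler01.
have a0 : bubble_angle 0 = 2 * (pi / 3) by rewrite /bubble_angle; ring.
have a1 : bubble_angle 1 = - (2 * (pi / 3)) by rewrite /bubble_angle; ring.
have E0 i : bubble i 0 = (0, 0).
  rewrite /bubble; case: i => [[|[|[|]]]] //= _;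
    rewrite /bubble_arc /bubble_segment ?a0; congr pair; ring.
have E1 i : bubble i 1 = (9 / 10 * Num.sqrt 3, 0).
  rewrite /bubble; case: i => [[|[|[|]]]] //= _;
    rewrite /bubble_arc /bubble_segment ?a1 ?sinN ?cosN ?sin_2pithird;
    by congr pair; field.
split.
- case=> [[|[|[|//]]]] lt_i; rewrite /bubble /=.
  + exact: (conj R1 H1).
  + exact: (conj R2 H2).
  + exact: (conj R3 H3).
- by move=> i j; rewrite !E0.
- by move=> i j; rewrite !E1.
- rewrite !big_ord_recl big_ord0 /bubble /=.
  rewrite (T1 _ I0).2 (T2 _ I0).2 (T3 _ I0).2 a0 cos_2pithird.
  by apply/eqP; rewrite /eq_op /=; apply/andP; split; apply/eqP; field.
- rewrite !big_ord_recl big_ord0 /bubble /=.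
  rewrite (T1 _ I1).2 (T2 _ I1).2 (T3 _ I1).2 a1 cosN sinN cos_2pithird.
  by apply/eqP; rewrite /eq_op /=; apply/andP; split; apply/eqP; field.
Qed.

Lemma network_energy_bubble : network_energy bubble = (bubble_energy R)%:E.
Proof.
rewrite /network_energy !big_ord_recl big_ord0 /bubble /=.
rewrite !bubble_arc_energy ?sqrrN ?expr1n// bubble_segment_energy.
by rewrite adde0 -!EFinD /bubble_energy; congr (_%:E); ring.
Qed.

End DoubleBubble.

(** The curve with the loop is arbitrary, so it is moved to the front; [V] is quantified inside
    because the same [j] and [k] serve tangents and energies. *)
Lemma sum_ord3 (i : 'I_3) : exists j k : 'I_3,
  forall (V : nmodType) (f : 'I_3 -> V), \sum_(l < 3) f l = f i + f j + f k.
Proof.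
pose i0 : 'I_3 := ord0; pose i1 : 'I_3 := lift ord0 ord0.
pose i2 : 'I_3 := lift ord0 (lift ord0 ord0).
have S (V : nmodType) (f : 'I_3 -> V) : \sum_(l < 3) f l = f i0 + f i1 + f i2.
  by rewrite !big_ord_recl big_ord0 addr0 addrA.
have [->|->|->] : [\/ i = i0, i = i1 | i = i2].
  by case: i => [[|[|[|//]]]] ?; [constructor 1|constructor 2|constructor 3];
    exact: val_inj.
- by exists i1, i2.
- by exists i0, i2 => V f; rewrite S (addrC (f i0)).
- by exists i0, i1 => V f; rewrite S addrC addrA.
Qed.

Theorem proposition4p11 (R : realType) (Gamma : 'I_3 -> R -> R * R)
  (Gamma_theta : theta_network Gamma)
  (Gamma_min : network_energy Gamma =
     ereal_inf [set network_energy Gamma' | Gamma' in @theta_network R]) :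
  network_injective Gamma.
Proof.
have [smooth P1 P2 angles0 angles1] := Gamma_theta.
have /choice[c cP] := fun i => curve_velocity (smooth i).1 (smooth i).2.
(* Minimality is used here only, against the double bubble. *)
have upper : \sum_(l < 3) venergy (c l) 0 1 <= bubble_energy R.
  rewrite -lee_fin -sumEFin -network_energy_bubble.
  apply: (@le_trans _ _ (network_energy Gamma)).
    by apply: lee_sum => l _; have [] := cP l.
  rewrite Gamma_min; apply: ereal_inf_lbound; exists (@bubble R).
    exact: theta_bubble.
  by [].
move=> i.
have no_loop a b : 0 <= a -> a < b -> b <= 1 -> Gamma i a <> Gamma i b.
  move=> a0 ab b1 loop; have [j [k S]] := sum_ord3 i.
  have tE l x : 0 <= x <= 1 -> tangent (Gamma l) x = vtan (c l) x.
    by have [tl _ _] := cP l; exact: tl.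
  have chord l q x y : 0 <= x -> x <= y -> y <= 1 ->
      dot2 q (Gamma l y) - dot2 q (Gamma l x) = vchord (c l) q x y.
    by have [_ cl _] := cP l; exact: cl.
  (* The curves share both endpoints, hence the displacement. *)
  have chord01 l l' q : vchord (c l) q 0 1 = vchord (c l') q 0 1.
    by rewrite -!chord ?lexx ?ler01// (P1 l l') (P2 l l').
  have : bubble_energy R < \sum_(l < 3) venergy (c l) 0 1.
    rewrite S; apply: (network_energy_loop a0 ab b1).
    - by move=> q; rewrite -(chord i q a b a0 (ltW ab) b1) loop subrr.
    - by move=> q; exact: chord01.
    - by move=> q; exact: chord01.
    - by move: angles0; rewrite S !tE ?lexx ?ler01.
    - by move: angles1; rewrite S !tE ?lexx ?ler01.
  by rewrite ltNge upper.
move=> x y; rewrite !in_itv /= => /andP[x0 x1] /andP[y0 y1] xy.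
by have [xly|ylx|//] := ltgtP x y; [case: (no_loop x y)|case: (no_loop y x)].
Qed.
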